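(* For each $n\in\mathbb{N}$, let $M_n$ be a random symmetric $n\times n$ matrix whose entries on and above the diagonal are independent and identically distributed, each taking the values $1$ and $-1$ with probability $1/2$ each, and let $q_n$ denote the probability that $M_n$ is singular. There exists $n_0\in\mathbb{N}$ such that for all $n\geq n_0$, $$q_n \leq 2^{-n^{1/4}\sqrt{\log n}/1000}.$$
   Context: $\log$ denotes the natural logarithm. Singularity is over $\mathbb{R}$ (equivalently $\mathbb{Q}$). *)

(* Defs.v *)
From HB Require Import structures.
From mathcomp Require Import all_boot all_order all_algebra.
From mathcomp Require Import all_classical all_reals all_analysis.

Set Implicit Arguments.
Unset Strict Implicit.
Unset Printing Implicit Defensive.

Import Order.TTheory GRing.Theory Num.Theory.
Import numFieldNormedType.Exports.

Local Open Scope classical_set_scope.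
Local Open Scope ring_scope.

Section RandomSymmetricMatrix.
Context (d : measure_display) (T : measurableType d) (R : realType).
Variable P : probability T R.

Definition mutually_independent (I : finType) (X : I -> {RV P >-> R}) : Prop :=
  forall (J : {set I}) (A : I -> set R), (forall i, measurable (A i)) ->
    P (\bigcap_(i in [set` J]) (X i @^-1` A i)) =
    (\prod_(i in J) P (X i @^-1` A i))%E.

Definition rademacher (X : {RV P >-> R}) : Prop :=
  P (X @^-1` [set 1]) = (2^-1)%:E /\ P (X @^-1` [set -1]) = (2^-1)%:E.

Definition upper_index (n : nat) : finType :=
  {p : 'I_n * 'I_n | (p.1 <= p.2)%N}.

Definition upper_entry (n : nat) (M : 'M[{RV P >-> R}]_n)
    (p : upper_index n) : {RV P >-> R} :=
  M (val p).1 (val p).2.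

Definition random_symmetric_sign_matrix (n : nat)
    (M : 'M[{RV P >-> R}]_n) : Prop :=
  [/\ M^T = M,
      forall p, rademacher (upper_entry M p) &
      mutually_independent (upper_entry M)].

Definition realization (n : nat) (M : 'M[{RV P >-> R}]_n) (w : T) : 'M[R]_n :=
  \matrix_(i, j) M i j w.

Definition singularity_probability (n : nat)
    (M : 'M[{RV P >-> R}]_n) : \bar R :=
  P [set w | realization M w \notin unitmx].

End RandomSymmetricMatrix.

(* Main.v *)
(** A singular integer matrix is singular modulo every prime, so we
work over [F_p] with [2^h < p <= 4^h] and [h] of order [sqrt n].

For a list [s] of elements of [F_p], the walk with steps [+- a], [a] in [s], hits
any point with probability at most the return probability of the lazy walk with
steps [0, 2a, -2a] of weights [3/4, 1/8, 1/8]; its law is positive definite, so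
the [a] for which [2a] is hit almost as often as [0] behave like an approximate
group. Given [v], choose greedily coordinates [t] that lower the lazy return
probability by a constant factor; after [O(log p)] choices, all other coordinates
are almost periods of the walk of [v_t]. By a doubling argument there are at most
half as many almost periods as the inverse of this return probability unless
they reduce to [0] or the return probability is already below [2/p]. As
[P(M v = w)] is at most its power [n - |t|], a union bound shows that
w.h.p. no solution [v <> 0] of [M v = w] is structured, that is, has all its lazy
return probabilities above [2/p].

Add rows and columns one at a time. When [M] is singular with an unstructured kernel
vector [v], the new column is not orthogonal to [v] and the corank drops, except
with probability [O(1/p)]. When [M] is invertible, the bordered matrix is singular only
if [x^T M^-1 x = z]. Resampling [x] on a small set of coordinates and one
Cauchy-Schwarz inequality turn this into a linear equation on the remaining
coordinates of [x], whose coefficient vector [v] solves [M v = w] for a fixed [w]. *)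
Require Import Defs.
From HB Require Import structures.
From mathcomp Require Import all_boot all_order all_algebra.
From mathcomp Require Import boolp zify ring lra.

Set Implicit Arguments.
Unset Strict Implicit.
Unset Printing Implicit Defensive.

Import Order.TTheory GRing.Theory Num.Theory.

(** * A prime in a dyadic range *)

(** By Legendre's formula the exponent of [p] is the sum over [k] of [n.*2 %/ p ^ k] minus twice
    [n %/ p ^ k]. Each term is 0 or 1 and vanishes once [p ^ k] exceeds [n.*2], so at most [t] terms
    count. *)
Lemma logn_central_bin_le p n : prime p -> 0 < n ->
  p ^ logn p 'C(n.*2, n) <= n.*2.
Proof.
move=> pr n0; have n2 : 0 < n.*2 by rewrite double_gt0.
have p1 := prime_gt1 pr; set t := trunc_log p n.*2.
apply: leq_trans (trunc_logP p1 n2); rewrite leq_pexp2l ?(ltnW p1) // -/t.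
have := congr1 (logn p) (bin_fact (leq_addr n n)); rewrite addnK addnn.
rewrite !lognM ?muln_gt0 ?fact_gt0 ?bin_gt0 -?addnn ?leq_addr // addnn.
rewrite !logn_fact // => hs.
have ext : \sum_(1 <= k < n.+1) n %/ p ^ k = \sum_(1 <= k < n.*2.+1) n %/ p ^ k.
  rewrite [RHS](big_cat_nat (n := n.+1)) //=; last by rewrite ltnS -addnn leq_addr.
  rewrite [X in _ + X]big_nat_cond [X in _ + X]big1 ?addn0 // => k.
  move=> /andP[/andP[nk _] _]; apply: divn_small.
  by apply: leq_trans (ltn_expl k p1); exact: leqW.
have le : \sum_(1 <= k < n.*2.+1) n.*2 %/ p ^ k <=
    \sum_(1 <= k < n.*2.+1) (n %/ p ^ k + n %/ p ^ k) + \sum_(1 <= k < n.*2.+1) (k <= t).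
  rewrite -big_split; apply: leq_sum => k _ /=.
  have pk0 : 0 < p ^ k by rewrite expn_gt0 ltnW.
  case: (leqP k t) => [_|tk].
    rewrite -addnn; have := divn_eq n (p ^ k); have := ltn_pmod n pk0.
    set d := p ^ k in pk0 *; set a := n %/ d; set r := n %% d => rd ->.
    rewrite -ltnS ltn_divLR //; nia.
  rewrite divn_small //; apply: leq_trans (trunc_log_ltn n.*2 p1) _.
  by rewrite leq_pexp2l // ltnW.
have cnt : \sum_(1 <= k < n.*2.+1) (k <= t) <= t.
  have -> : \sum_(1 <= k < n.*2.+1) (k <= t) = \sum_(1 <= k < n.*2.+1 | k < t.+1) 1.
    by rewrite [RHS]big_mkcond; apply: eq_bigr => k _; rewrite ltnS; case: (k <= t).
  rewrite sum1_count -size_filter.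
  rewrite -[leqRHS](size_iota 1 t); apply: uniq_leq_size.
    by rewrite filter_uniq // iota_uniq.
  by move=> k; rewrite mem_filter mem_index_iota mem_iota add1n => /andP[-> /andP[->]].
rewrite big_split /= in le; lia.
Qed.

(** If every prime factor of the central binomial coefficient were at most [x], there would be at
    most [x] of them, each contributing at most [n.*2]. The coefficient would be at most [n.*2 ^ x],
    but it is at least [2 ^ n]. *)
Lemma exists_prime_between x n : 0 < n -> n.*2 ^ x < 2 ^ n ->
  exists p, [/\ prime p, x < p & p <= n.*2].
Proof.
move=> n0 hx; pose m := 'C(n.*2, n).
have m0 : 0 < m by rewrite bin_gt0 -addnn leq_addr.
case: (boolP (has (fun p => x < p) (primes m))) => [/hasP[p pm xp]|no].
  have := pm; rewrite mem_primes => /and3P[pr _ pd]; exists p; split => //.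
  have := logn_central_bin_le pr n0; apply: leq_trans.
  by rewrite -[leqLHS]expn1 leq_pexp2l ?(prime_gt0 pr) // logn_gt0.
have : m <= n.*2 ^ x.
  rewrite [leqLHS](prod_prime_decomp m0) prime_decompE big_map /=.
  apply: leq_trans (_ : \prod_(p <- primes m) n.*2 <= _).
    rewrite big_seq [leqRHS]big_seq; apply: leq_prod => p; rewrite mem_primes => /and3P[pr _ _].
    exact: logn_central_bin_le.
  rewrite big_const_seq count_predT iter_muln muln1 leq_pexp2l ?double_gt0 //.
  rewrite -[leqRHS](size_iota 1 x); apply: uniq_leq_size; first exact: primes_uniq.
  move=> p pm; have := hasPn no p pm; rewrite -leqNgt mem_iota add1n ltnS => ->.
  by move: pm; rewrite mem_primes andbT => /andP[/prime_gt0].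
have : 2 ^ n <= m.
  rewrite /m => {m m0 no}; elim: n n0 {hx} => // -[|n] IH _.
    by rewrite /= bin1.
  have {IH} IH := IH isT.
  apply: leq_trans (_ : 2 * 'C(n.+1.*2, n.+1) <= _); first by rewrite expnS leq_mul2l.
  rewrite -[n.+2.*2]/(n.+1.*2.+2) !binS.
  have : 'C(n.+1.*2, n.+2) = 'C(n.+1.*2, n).
    by rewrite -bin_sub -?addnn; [congr 'C(_, _); lia | lia].
  lia.
lia.
Qed.

Local Open Scope ring_scope.

(** * Fair and lazy walks *)

Section PositiveDefinite.
Variables (R : realFieldType) (V : finZmodType).
Implicit Types (K : V -> R) (x y a : V) (s : seq V).

(** Test points form a weighted list with repetitions allowed, so that shifting or splitting points
    yields another instance. *)
Definition positive_definite K := forall l : seq (R * V),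
  0 <= \sum_(u <- l) \sum_(w <- l) u.1 * w.1 * K (u.2 - w.2).

Lemma eq_positive_definite K K' :
  K =1 K' -> positive_definite K -> positive_definite K'.
Proof.
move=> eqK pdK l; have := pdK l; congr (0 <= _).
by apply: eq_bigr => u _; apply: eq_bigr => w _; rewrite eqK.
Qed.

Lemma positive_definite_avg K K' : positive_definite K -> positive_definite K' ->
  positive_definite (fun x => 2^-1 * (K x + K' x)).
Proof.
move=> pdK pdK' l; have := addr_ge0 (pdK l) (pdK' l).
rewrite -big_split /= => h; rewrite -(pmulr_rge0 _ (ltr0n R 2)); move: h.
congr (0 <= _); rewrite mulr_sumr; apply: eq_bigr => u _.
by rewrite -big_split mulr_sumr; apply: eq_bigr => w _ /=; field.
Qed.

(** The quadratic form is the sum over [x] of the squared total weight placed at [x]. *)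
Lemma positive_definite_dirac : positive_definite (fun x => (x == 0)%:R).
Proof.
move=> l; have -> : \sum_(u <- l) \sum_(w <- l) u.1 * w.1 * (u.2 - w.2 == 0)%:R =
    \sum_(x : V) (\sum_(u <- l) u.1 * (u.2 == x)%:R) ^+ 2.
  under [RHS]eq_bigr => x _ do rewrite expr2 mulr_suml.
  rewrite [RHS]exchange_big /=; apply: eq_bigr => u _.
  under [RHS]eq_bigr => x _ do rewrite mulr_sumr.
  rewrite [RHS]exchange_big /=; apply: eq_bigr => w _.
  rewrite (bigD1 u.2) //= big1 => [|x /negPf xu].
    by rewrite eqxx addr0 mulr1 -mulrA subr_eq0 eq_sym.
  by rewrite (eq_sym u.2) xu mulr0 mul0r.
by apply: sumr_ge0 => x _; apply: sqr_ge0.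
Qed.

(* Convolving twice with the signed measure [delta_0 + c/2 (delta_a + delta_-a)],
   which is symmetric, turns the quadratic form of [K] into its value at a
   transformed list of points. *)
Lemma positive_definite_square K a (c : R) : positive_definite K ->
  positive_definite (fun x => K x + c * (K (x + a) + K (x - a)) +
    c ^+ 2 / 4 * (K (x + (a + a)) + K (x - (a + a)) + 2 * K x)).
Proof.
move=> pdK l.
pose f (u : R * V) := [:: u; (c / 2 * u.1, u.2 + a); (c / 2 * u.1, u.2 - a)].
have := pdK (flatten [seq f u | u <- l]).
rewrite big_flatten /= big_map; congr (0 <= _); apply: eq_bigr => u _.
rewrite !big_cons big_nil /= addr0 !big_flatten /= !big_map -!big_split.
apply: eq_bigr => w _ /=.
rewrite !big_cons !big_nil /= !addr0.
have e1 : u.2 - (w.2 + a) = u.2 - w.2 - a by rewrite opprD addrA.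
have e2 : u.2 - (w.2 - a) = u.2 - w.2 + a by rewrite opprD opprK addrA.
have e3 : u.2 + a - w.2 = u.2 - w.2 + a by rewrite addrAC.
have e4 : u.2 - a - w.2 = u.2 - w.2 - a by rewrite addrAC.
have e5 : u.2 + a - (w.2 + a) = u.2 - w.2 by rewrite opprD addrACA subrr addr0.
have e6 : u.2 + a - (w.2 - a) = u.2 - w.2 + (a + a).
  by rewrite opprD opprK addrACA.
have e7 : u.2 - a - (w.2 + a) = u.2 - w.2 - (a + a).
  by rewrite opprD addrACA -opprD.
have e8 : u.2 - a - (w.2 - a) = u.2 - w.2 by rewrite opprD opprK addrACA addNr addr0.
by rewrite e1 e2 e3 e4 e5 e6 e7 e8; field.
Qed.

Lemma positive_definite_le0 K x : positive_definite K ->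
  K (- x) = K x -> `|K x| <= K 0.
Proof.
move=> pdK Kx; have h1 := pdK [:: (1, 0); (1, x)]; have h2 := pdK [:: (1, 0); (-1, x)].
rewrite !big_cons !big_nil /= !subrr sub0r subr0 Kx in h1 h2.
by rewrite ler_norml; apply/andP; split; lra.
Qed.

(** Test with weights 1, -2, 1 at 0, [x], [x + y]. The gap [K 0 - K x] acts as a squared distance,
    hence the factor 2. *)
Lemma positive_definite_quasi_triangle K x y : positive_definite K ->
  (forall z, K (- z) = K z) ->
  K 0 - K (x + y) <= 2 * (K 0 - K x) + 2 * (K 0 - K y).
Proof.
move=> pdK Ke; have := pdK [:: (1, 0); (-2, x); (1, x + y)].
rewrite !big_cons !big_nil /= !subrr !sub0r !subr0.
have -> : x - (x + y) = - y by rewrite opprD addrA subrr sub0r.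
have -> : x + y - x = y by rewrite addrAC subrr add0r.
by rewrite !Ke; lra.
Qed.

Fixpoint walk s x : R :=
  if s is a :: s' then (walk s' (x + a) + walk s' (x - a)) / 2 else (x == 0)%:R.

Fixpoint lazy_walk s x : R :=
  if s is a :: s' then
    3 / 4 * lazy_walk s' x + (lazy_walk s' (x + (a + a)) + lazy_walk s' (x - (a + a))) / 8
  else (x == 0)%:R.

Lemma walkN s x : walk s (- x) = walk s x.
Proof.
elim: s x => [|a s IH] x /=; first by rewrite oppr_eq0.
have e1 : - x + a = - (x - a) by rewrite opprB addrC.
by rewrite e1 -opprD !IH addrC.
Qed.

Lemma lazy_walkN s x : lazy_walk s (- x) = lazy_walk s x.
Proof.
elim: s x => [|a s IH] x /=; first by rewrite oppr_eq0.
have e1 : - x + (a + a) = - (x - (a + a)) by rewrite opprB addrC.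
by rewrite IH e1 -[- x - _]opprD !IH [X in _ + X / 8]addrC.
Qed.

(* With [S] the convolution by a fair step [+- a], a lazy step is
   [B = (1 + S ^ 2) / 2], and [B + S] and [B - S] are halves of squares. *)
Lemma lazy_walk_pm_positive_definite s :
  positive_definite (fun x => lazy_walk s x + walk s x) /\
  positive_definite (fun x => lazy_walk s x - walk s x).
Proof.
elim: s => [|a s [IHp IHm]] /=.
  split.
    (* With shift 0, the squares for [c = 1] and [c = -1] multiply a kernel by 4 and by 0; their
       average doubles the point mass at 0. *)
    have pd := @positive_definite_square _ 0 1 positive_definite_dirac.
    have p0 := @positive_definite_square _ 0 (-1) positive_definite_dirac.
    apply: eq_positive_definite (positive_definite_avg pd p0) => x.
    by rewrite !(subrr, addr0, subr0); field.
  by move=> l; under eq_bigr => u _ do under eq_bigr => w _ do rewrite subrr mulr0;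
     rewrite big1 // => u _; rewrite big1.
(* Write [L] and [W] for the lazy and fair laws of [s]. Then [(1 + S)^2 (L + W)] and
   [(1 - S)^2 (L - W)] average to [(1 + S^2) L + 2 S W], twice the new sum; exchanging [L + W] and
   [L - W] gives twice the new difference. *)
have [p1 m1] := (@positive_definite_square _ a 1 IHp, @positive_definite_square _ a (-1) IHm).
have [p2 m2] := (@positive_definite_square _ a 1 IHm, @positive_definite_square _ a (-1) IHp).
have [q1 q2] := (positive_definite_avg p1 m1, positive_definite_avg p2 m2).
(* The square with shift 0 and [c = -1] is the zero kernel, so averaging with it halves. *)
have z := positive_definite_avg q1 (@positive_definite_square _ 0 (-1) q1).
have z2 := positive_definite_avg q2 (@positive_definite_square _ 0 (-1) q2).
split.
  by apply: eq_positive_definite z => x; rewrite !(addr0, subr0); field.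
by apply: eq_positive_definite z2 => x; rewrite !(addr0, subr0); field.
Qed.

Lemma lazy_walk_positive_definite s : positive_definite (lazy_walk s).
Proof.
have [hp hm] := lazy_walk_pm_positive_definite s.
by apply: eq_positive_definite (positive_definite_avg hp hm) => x; field.
Qed.

(** Lazy plus fair at [x] is at most its value at 0, and lazy minus fair at [x] is at least minus
    its value at 0. Combining the two cancels [lazy_walk s x] and [walk s 0]. *)
Lemma walk_le_lazy_walk s x : walk s x <= lazy_walk s 0.
Proof.
have [hp hm] := lazy_walk_pm_positive_definite s.
have h1 := positive_definite_le0 (x := x) hp; have h2 := positive_definite_le0 (x := x) hm.
rewrite /= walkN lazy_walkN in h1 h2.
move: (h1 erefl) (h2 erefl); rewrite !ler_norml => /andP[_ h3] /andP[h4 _]; lra.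
Qed.

Lemma lazy_walk_le0 s x : lazy_walk s x <= lazy_walk s 0.
Proof.
apply: le_trans (ler_norm _) _; apply: positive_definite_le0.
  exact: lazy_walk_positive_definite.
exact: lazy_walkN.
Qed.

Lemma lazy_walk_ge0 s x : 0 <= lazy_walk s x.
Proof.
elim: s x => [|a s IH] x /=; first exact: ler0n.
by have := (IH x, IH (x + (a + a)), IH (x - (a + a))); move=> [[]]; lra.
Qed.

Lemma sum_lazy_walk s : \sum_x lazy_walk s x = 1.
Proof.
elim: s => [|a s IH] /=.
  by rewrite (bigD1 0) //= eqxx big1 ?addr0 // => x /negPf->.
rewrite big_split /= -mulr_sumr IH -mulr_suml big_split /=.
rewrite -(reindex_inj (h := fun x => x + (a + a)) (F := lazy_walk s) (P := predT)) /=;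
  last exact: addIr.
rewrite -(reindex_inj (h := fun x => x - (a + a)) (F := lazy_walk s) (P := predT)) /=;
  last exact: addIr.
by rewrite IH; field.
Qed.

Lemma lazy_walk0_ge s : (#|V|%:R)^-1 <= lazy_walk s 0.
Proof.
have V_gt0 : 0 < #|V|%:R :> R by rewrite ltr0n; apply/card_gt0P; exists 0.
rewrite -(ler_pM2l V_gt0) divff ?gt_eqF // -[leLHS](sum_lazy_walk s).
rewrite mulr_natl -sumr_const; apply: ler_sum => x _; exact: lazy_walk_le0.
Qed.

Lemma lazy_walk0_le1 s : lazy_walk s 0 <= 1.
Proof.
rewrite -(sum_lazy_walk s) (bigD1 0) //= lerDl; apply: sumr_ge0 => x _.
exact: lazy_walk_ge0.
Qed.

Lemma walk_cat_le s s' (c : R) :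
  (forall x, walk s' x <= c) -> forall x, walk (s ++ s') x <= c.
Proof.
move=> h; elim: s => [|a s IH] x //=.
by have := (IH (x + a), IH (x - a)); move=> []; lra.
Qed.

Lemma lazy_walk_cons0 a s :
  lazy_walk (a :: s) 0 = 3 / 4 * lazy_walk s 0 + lazy_walk s (a + a) / 4.
Proof. by rewrite /= add0r sub0r lazy_walkN; field. Qed.

(** Lazy steps are symmetric. This removes the signs of the matrix entries from the coefficients of
    a row. *)
Lemma lazy_walk_map_sign (I : Type) (e : I -> bool) (f : I -> V) (t : seq I) :
  lazy_walk [seq if e i then f i else - f i | i <- t] =1 lazy_walk [seq f i | i <- t].
Proof.
elim: t => [|i t IH] x //=; rewrite !IH; case: (e i) => //.
by rewrite -opprD opprK [X in _ + X / 8]addrC.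
Qed.

End PositiveDefinite.

(** * Almost periods *)

Section AlmostPeriods.
Variables (R : realFieldType) (V : finZmodType).
Implicit Types (t u : R) (a b : V) (s : seq V).
Local Notation lazy_walk := (@lazy_walk R V).

(** The shift [a + a] is that of a lazy step: prepending [a] to [s] lowers the return probability by
    a quarter of this gap. *)
Definition almost_periods s t : {set V} :=
  [set a | lazy_walk s 0 - lazy_walk s (a + a) <= t * lazy_walk s 0].

Lemma almost_periods_mono s t u : t <= u -> almost_periods s t \subset almost_periods s u.
Proof.
move=> tu; apply/subsetP => a; rewrite !inE => /le_trans; apply.
by rewrite ler_wpM2r ?lazy_walk_ge0.
Qed.

Lemma almost_periods0 s t : 0 <= t -> 0 \in almost_periods s t.
Proof. by move=> t0; rewrite inE addr0 subrr mulr_ge0 ?lazy_walk_ge0. Qed.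

Lemma almost_periodsN s t a : (- a \in almost_periods s t) = (a \in almost_periods s t).
Proof. by rewrite !inE -opprD lazy_walkN. Qed.

Lemma almost_periodsD s t u a b : a \in almost_periods s t -> b \in almost_periods s u ->
  a + b \in almost_periods s (2 * t + 2 * u).
Proof.
rewrite !inE => ha hb; rewrite addrACA.
have := positive_definite_quasi_triangle (a + a) (b + b)
  (@lazy_walk_positive_definite R _ s) (lazy_walkN _ s).
by move=> h; lra.
Qed.

Hypothesis mulrn_surj : forall a b, a != 0 -> exists k, b = a *+ k.

(* The first multiple of [a] outside the set at level [4 t] is a translation
   which moves the set at level [t] off itself. *)
Lemma almost_periods_doubling s t a c : 0 <= t ->
  a != 0 -> a \in almost_periods s t -> c \notin almost_periods s (4 * t) ->
  (2 * #|almost_periods s t| <= #|almost_periods s (22 * t)|)%N.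
Proof.
move=> t0 a0 at_ ct; pose Q k := a *+ k \notin almost_periods s (4 * t).
have exQ : exists k, Q k by have [k ck] := mulrn_surj c a0; exists k; rewrite /Q -ck.
case: (ex_minnP exQ) => -[|k] yk kmin.
  by move: yk; rewrite /Q mulr0n almost_periods0 //; lra.
have {kmin} k4 : a *+ k \in almost_periods s (4 * t).
  by apply/negPn/negP => /kmin; rewrite ltnn.
pose y := a *+ k.+1.
(* The levels are [2 t + 2 (4 t) = 10 t] for [y], then [2 (10 t) + 2 t = 22 t] for the translate of
   [L] by [y]. *)
have y10 : y \in almost_periods s (10 * t).
  rewrite /y mulrS; apply: subsetP (almost_periodsD at_ k4).
  by apply: almost_periods_mono; lra.
pose L := almost_periods s t.
have inj : injective (fun x => y + x) by exact: addrI.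
have dis : [disjoint L & [set y + x | x in L]].
  rewrite -setI_eq0; apply/eqP/setP => x; rewrite !inE -/L; apply/negbTE/negP.
  move=> /andP[xL /imsetP[z zL xE]]; move/negP: yk; apply.
  rewrite /Q -/y (_ : y = x + - z); last by rewrite xE addrK.
  rewrite (_ : 4 * t = 2 * t + 2 * t); last by ring.
  by apply: almost_periodsD => //; [rewrite !inE in xL * | rewrite almost_periodsN].
have := card_imset L inj; rewrite mul2n -addnn => {2}<-.
move: dis; rewrite -leq_card_setU => /eqP<-; apply: subset_leq_card.
rewrite subUset; apply/andP; split; first by apply: almost_periods_mono; lra.
apply/subsetP => x /imsetP[z zL ->]; apply: subsetP (almost_periodsD y10 zL).
by apply: almost_periods_mono; lra.
Qed.

Hypothesis double_inj : injective (fun a : V => a + a).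

(** The points [a + a] are distinct, each carries at least half the return probability, and the
    total mass is 1. *)
Lemma card_almost_periods_half s : #|almost_periods s (1 / 2)|%:R * lazy_walk s 0 <= 2.
Proof.
have : \sum_(a in almost_periods s (1/2)) lazy_walk s (a + a) <= 1.
  rewrite -[leRHS](sum_lazy_walk R s) [leRHS](reindex_inj double_inj) /=.
  rewrite [leRHS](bigID (mem (almost_periods s (1/2)))) /= lerDl.
  by apply: sumr_ge0 => x _; apply: lazy_walk_ge0.
apply: contraTT; rewrite -!ltNge => h.
apply: lt_le_trans (_ : \sum_(a in almost_periods s (1/2)) (lazy_walk s 0 / 2) <= _).
  by rewrite sumr_const -[ltRHS]mulr_natl; lra.
by apply: ler_sum => a; rewrite inE; lra.
Qed.

(** Since [968 = 2 * 22 ^ 2], two doublings raise the tolerance exactly to 1/2. *)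
Definition period_tol : R := 968^-1.

(** A nonzero almost period allows two doublings, so the set at level 1/2 is at least four times
    larger, while its size times the return probability is at most 2. The assumption on [s] leaves
    an element outside that set, as the doubling requires. *)
Lemma almost_periods_small s : 2 < #|V|%:R * lazy_walk s 0 ->
  almost_periods s period_tol = [set 0] \/
  #|almost_periods s period_tol|%:R * lazy_walk s 0 <= 1 / 2.
Proof.
move=> big; have half := card_almost_periods_half s.
have [[a aL a0]|none] := pselect (exists2 a, a \in almost_periods s period_tol & a != 0);
  last first.
  left; apply/setP => x; rewrite in_set1; apply/idP/eqP => [xL|->].
    by apply/eqP/negPn/negP => x0; apply: none; exists x.
  by apply: almost_periods0; rewrite /period_tol; lra.
right; have [c cN] : exists c, c \notin almost_periods s (1 / 2).
  apply/existsP; rewrite -negb_forall; apply/negP => /forallP all1.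
  have : almost_periods s (1/2) = setT by apply/setP => x; rewrite (all1 x) in_setT.
  by move=> e; rewrite e cardsT in half; lra.
have cN' u : u <= 1 / 2 -> c \notin almost_periods s u.
  by move=> u2; apply: contra cN; apply/subsetP/almost_periods_mono.
have t0 : 0 <= period_tol by rewrite /period_tol; lra.
have h1 := almost_periods_doubling t0 a0 aL (cN' _ _).
have aL2 : a \in almost_periods s (22 * period_tol).
  by apply: subsetP aL; apply: almost_periods_mono; rewrite /period_tol; lra.
have h2 := almost_periods_doubling (mulr_ge0 (ler0n _ 22) t0) a0 aL2 (cN' _ _).
have {h1} h1 := h1 ltac:(rewrite /period_tol; lra).
have {h2} := h2 ltac:(rewrite /period_tol; lra).
have -> : 22 * (22 * period_tol) = 1 / 2 :> R by rewrite /period_tol; field.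
move=> h2; have : (4 * #|almost_periods s period_tol| <= #|almost_periods s (1/2)|)%N.
  by apply: leq_trans h2; rewrite -[4%N]/(2 * 2)%N -mulnA leq_mul2l.
rewrite -(ler_nat R) natrM => h.
have := lazy_walk_ge0 R s 0; nra.
Qed.

(** A coordinate violating the last clause, once added to [t], multiplies the return probability by
    at most [1 - period_tol / 4]. After [m] additions it would be below the least possible value,
    the inverse of [#|V|]. *)
Lemma greedy_almost_periods (I : finType) (v : I -> V) (K : {set I}) (m : nat) :
  #|V|%:R * (1 - period_tol / 4) ^+ m < 1 ->
  exists t : seq I, [/\ uniq t, {subset t <= K}, (size t <= m)%N &
    forall i, i \in K -> i \notin t ->
      v i \in almost_periods [seq v j | j <- t] period_tol].
Proof.
move=> hm.
have step k : exists t : seq I, [/\ uniq t, {subset t <= K}, (size t <= k)%N &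
    (forall i, i \in K -> i \notin t ->
      v i \in almost_periods [seq v j | j <- t] period_tol) \/
    lazy_walk [seq v j | j <- t] 0 <= (1 - period_tol / 4) ^+ k].
  elim: k => [|k [t [ut tK sz [good|small]]]].
  - by exists [::]; split => //; right; rewrite expr0 lazy_walk0_le1.
  - by exists t; split => //; [exact: leqW|left].
  have [good|] := pselect (forall i, i \in K -> i \notin t ->
      v i \in almost_periods [seq v j | j <- t] period_tol).
    by exists t; split => //; [exact: leqW|left].
  move=> /existsNP[i /not_implyP[iK /not_implyP[it /negP]]]; rewrite inE -ltNge => hi.
  exists (i :: t); split => /=; first by rewrite it.
  - by move=> j; rewrite inE => /orP[/eqP->|/tK].
  - by rewrite ltnS.
  right; rewrite -/(lazy_walk (v i :: _) 0) lazy_walk_cons0 exprS.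
  have t0 : 0 <= 1 - period_tol / 4 by rewrite /period_tol; lra.
  apply: le_trans (ler_wpM2l t0 small); move: hi; lra.
have [t [ut tK sz [good|small]]] := step m; first by exists t.
have Vgt0 : 0 < #|V|%:R :> R by rewrite ltr0n; apply/card_gt0P; exists 0.
have := lazy_walk0_ge R [seq v j | j <- t]; rewrite -(ler_pM2l Vgt0) divff ?gt_eqF //.
by move/le_trans => /(_ _ (ler_wpM2l (ltW Vgt0) small)); rewrite leNgt hm.
Qed.

End AlmostPeriods.

(** * Random signs *)

Section SignCounting.
Variables (R : realFieldType) (F : finFieldType).
Local Notation walk := (@walk R F).
Local Notation lazy_walk := (@lazy_walk R F).

(** In the induction each [e] is averaged with its flip at [i], which leaves the sum over the tail
    unchanged because [t] has no repetitions. *)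
Lemma sum_sign_eq (I : finType) (a : I -> F) (t : seq I) (c : F) : uniq t ->
  \sum_(e : {ffun I -> bool}) (\sum_(j <- t) (-1) ^+ e j * a j == c)%:R =
  2 ^+ #|I| * walk [seq a j | j <- t] c.
Proof.
elim: t c => [|i t IH] c /=.
  move=> _; under eq_bigr => e _ do rewrite big_nil eq_sym.
  by rewrite sumr_const card_ffun card_bool -[LHS]mulr_natl natrX.
move=> /andP[it ut].
pose flip (e : {ffun I -> bool}) := [ffun j => e j (+) (j == i)].
have flipK : involutive flip.
  by move=> e; apply/ffunP => j; rewrite !ffunE -addbA addbb addbF.
pose S e := \sum_(j <- t) (-1) ^+ (e : {ffun I -> bool}) j * a j.
have Sflip e : S (flip e) = S e.
  rewrite /S big_seq [RHS]big_seq; apply: eq_bigr => j jt; rewrite ffunE.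
  by case: eqP jt it => [->|_ _ _]; [move=> -> | rewrite addbF].
under eq_bigr => e _ do rewrite big_cons -/(S e).
set X := LHS; have X2 : X + X = 2 ^+ #|I| * (walk [seq a j | j <- t] (c + a i) +
    walk [seq a j | j <- t] (c - a i)).
  rewrite {2}/X (reindex_inj (inv_inj flipK)) /= -big_split mulrDr -!IH // -big_split.
  apply: eq_bigr => e _ /=; rewrite Sflip ffunE eqxx addbT -/(S e).
  case: (e i); rewrite /= ?expr0 ?expr1 ?mulN1r ?mul1r ?[_ + S e]addrC.
    by rewrite subr_eq (eq_sym (S e) (c - _)) subr_eq (eq_sym c).
  by rewrite addrC subr_eq (eq_sym (S e) (c - _)) subr_eq (eq_sym c).
lra.
Qed.

(** With the coordinates of [t] put last, the other signs only average translates of the walk over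
    [t] and cannot raise its maximum. *)
Lemma sum_sign_eq_le (I : finType) (a : I -> F) (K : {set I}) (t : seq I) (c : F) :
  uniq t -> {subset t <= K} ->
  \sum_(e : {ffun I -> bool}) (\sum_(j in K) (-1) ^+ e j * a j == c)%:R <=
  2 ^+ #|I| * lazy_walk [seq a j | j <- t] 0.
Proof.
move=> ut tK; pose u := [seq j <- enum K | j \notin t].
have uu : uniq (u ++ t).
  rewrite cat_uniq ut filter_uniq ?enum_uniq //= andbT; apply/hasPn => j jt.
  by rewrite mem_filter jt.
have pe : perm_eq (enum K) (u ++ t).
  apply: uniq_perm => // [|j]; first exact: enum_uniq.
  rewrite mem_cat [j \in u]mem_filter !mem_enum; case jt : (j \in t) => /=.
    exact: tK.
  by rewrite orbF.
under eq_bigr => e _ do rewrite -big_enum (perm_big _ pe).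
rewrite sum_sign_eq // map_cat ler_wpM2l ?exprn_ge0 //.
by apply: walk_cat_le => x; apply: walk_le_lazy_walk.
Qed.

Definition sign_sym n : {set 'M[F]_n} :=
  [set A | (A^T == A) && [forall i, forall j, (A i j == 1) || (A i j == -1)]].

Lemma sign_symP n (A : 'M[F]_n) :
  reflect (A^T = A /\ forall i j, A i j = 1 \/ A i j = -1) (A \in sign_sym n).
Proof.
rewrite inE; apply: (iffP andP) => -[h1 h2]; split.
- exact/eqP.
- by move=> i j; move/forallP/(_ i)/forallP/(_ j)/orP: h2 => [/eqP|/eqP]; [left|right].
- exact/eqP.
- by apply/forallP => i; apply/forallP => j; case: (h2 i j) => ->; rewrite eqxx ?orbT.
Qed.

(* Independent uniform sign flips of the entries outside the [t]-rows and in the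
   [t]-columns (and of the symmetric entries) preserve the uniform measure. *)
Lemma card_sign_sym_mulmx_le n (v w : 'cV[F]_n) (t : seq 'I_n) : uniq t ->
  #|[set A in sign_sym n | A *m v == w]|%:R <=
  lazy_walk [seq v i 0 | i <- t] 0 ^+ (n - size t) * #|sign_sym n|%:R.
Proof.
move=> ut; pose row_t := {ffun 'I_n -> bool}; pose E := {ffun 'I_n -> row_t}.
pose sg (e : E) i j : bool :=
  if (i \notin t) && (j \in t) then e i j
  else if (j \notin t) && (i \in t) then e j i else false.
have sgC e i j : sg e i j = sg e j i.
  by rewrite /sg; case: (i \in t); case: (j \in t).
pose tw e (A : 'M[F]_n) : 'M[F]_n := \matrix_(i, j) ((-1) ^+ sg e i j * A i j).
have twK e : involutive (tw e).
  by move=> A; apply/matrixP => i j; rewrite !mxE mulrA -signr_addb addbb expr0 mul1r.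
have tw_sym e A : (tw e A \in sign_sym n) = (A \in sign_sym n).
  suff imp B : B \in sign_sym n -> tw e B \in sign_sym n.
    by apply/idP/idP => [/imp|/imp//]; rewrite twK.
  move=> /sign_symP[BT B1]; apply/sign_symP; split.
    by apply/matrixP => i j; rewrite !mxE sgC -{1}BT mxE.
  move=> i j; rewrite mxE mulr_sign.
  by case: (B1 i j) => ->; case: (sg e i j); rewrite ?opprK; auto.
pose L := lazy_walk [seq v i 0 | i <- t] 0.
pose S := sign_sym n.
have cardE : \sum_(A in S) (A *m v == w)%:R = #|[set A in S | A *m v == w]|%:R :> R.
  rewrite -natr_sum -sum1_card; congr (_ %:R).
  by rewrite [RHS](eq_bigl (fun A => (A \in S) && (A *m v == w))) ?big_mkcondr //= => A;
     rewrite inE.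
rewrite -cardE -/S -/L.
pose N : R := (2 ^+ n) ^+ n.
have N_gt0 : 0 < N by rewrite !exprn_gt0.
rewrite -(ler_pM2l N_gt0).
have -> : N * \sum_(A in S) (A *m v == w)%:R =
    \sum_(A in S) \sum_(e : E) (tw e A *m v == w)%:R.
  rewrite [RHS]exchange_big /=.
  rewrite [RHS](eq_bigr (fun=> \sum_(A in S) (A *m v == w)%:R)).
    by rewrite sumr_const /E card_ffun /row_t card_ffun card_bool card_ord -[RHS]mulr_natl !natrX.
  move=> e _; rewrite [RHS](reindex_inj (inv_inj (twK e))) /=.
  by apply: eq_bigl => A; rewrite tw_sym.
rewrite [leRHS](_ : _ = \sum_(A in S) N * L ^+ (n - size t)); last first.
  by rewrite sumr_const -[RHS]mulr_natl; ring.
apply: ler_sum => A AS; have [_ A1] := sign_symP _ AS.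
(* For [i] outside [t], row [i] of the twisted equation involves only the signs [e i]; rows in [t]
   are left unconstrained. *)
pose cond i (f : row_t) := (i \in t) ||
  (\sum_(j in [set j in t]) (-1) ^+ f j * (A i j * v j 0) ==
   w i 0 - \sum_(j | j \notin t) A i j * v j 0).
apply: le_trans (_ : \sum_(e : E) \prod_i (cond i (e i))%:R <= _).
  apply: ler_sum => e _; case: eqP => [tv|_]; last by apply: prodr_ge0.
  rewrite big1 // => i _; rewrite /cond; case: (boolP (i \in t)) => //= it.
  suff -> : \sum_(j in [set j in t]) (-1) ^+ e i j * (A i j * v j 0) ==
     w i 0 - \sum_(j | j \notin t) A i j * v j 0 by [].
  rewrite eq_sym subr_eq -tv mxE (bigID (mem t)) /=; apply/eqP; congr (_ + _).
    rewrite [RHS](eq_bigl (mem t)) => [|j]; last by rewrite inE.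
    by apply: eq_bigr => j jt; rewrite mxE /sg it jt /= mulrA.
  apply: eq_bigr => j jt; rewrite mxE /sg it (negPf jt) /=.
  by rewrite (negPf it) /= expr0 mul1r.
(* Different rows use different components of [e], so the sum over [e] factors. *)
rewrite -(bigA_distr_bigA (fun i (f : row_t) => (cond i f)%:R : R)) /=.
apply: le_trans (_ : \prod_i (2 ^+ n * (if i \in t then 1 else L)) <= _).
  apply: ler_prod => i _; apply/andP; split; first exact: sumr_ge0.
  case: (boolP (i \in t)) => it.
    under eq_bigr => f _ do rewrite /cond it /=.
    by rewrite sumr_const /row_t card_ffun card_bool card_ord mulr1 natrX.
  under eq_bigr => f _ do rewrite /cond (negPf it) /=.
  have := @sum_sign_eq_le _ (fun j => A i j * v j 0) [set j in t] t
    (w i 0 - \sum_(j | j \notin t) A i j * v j 0) ut.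
  rewrite card_ord => h; apply: (le_trans (h _)) => [j jt|]; first by rewrite inE.
  rewrite ler_wpM2l ?exprn_ge0 // /L.
  rewrite -(lazy_walk_map_sign R (fun j => A i j == 1) (fun j => v j 0) t).
  rewrite (_ : [seq A i j * v j 0 | j <- t] =
    [seq if A i j == 1 then v j 0 else - v j 0 | j <- t]) //.
  apply: eq_map => j; case: eqP => [->|]; first by rewrite mul1r.
  by case: (A1 i j) => -> //; rewrite mulN1r.
rewrite big_split prodr_const card_ord /= /N ler_wpM2l ?exprn_ge0 //.
rewrite (bigID (mem t)) /= big1 ?mul1r => [|i ->//].
rewrite (eq_bigr (fun=> L)) => [|i /negPf->//].
rewrite prodr_const (_ : #|_| = n - size t)%N //.
by have := cardC (mem t); rewrite (card_uniqP ut) card_ord => /(canRL (addKn _)) <-.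
Qed.

End SignCounting.

(** * Structured solutions *)

Lemma card_family_prod (aT rT : finType) (A : aT -> {set rT}) :
  #|[set f : {ffun aT -> rT} | [forall x, f x \in A x]]| = (\prod_x #|A x|)%N.
Proof.
rewrite (_ : #|_| = #|(family A : simpl_pred _)|).
  by rewrite card_family foldrE big_image /=.
by apply: eq_card => f; rewrite inE; apply/forallP/familyP.
Qed.

Lemma card_bigcup_le (I T : finType) (P : pred I) (A : I -> {set T}) :
  (#|\bigcup_(i | P i) A i| <= \sum_(i | P i) #|A i|)%N.
Proof.
elim/big_rec2: _ => [|i m B _ IH]; first by rewrite cards0.
by apply: leq_trans (leq_card_setU _ _) _; rewrite leq_add2l.
Qed.

Section Structured.
Variables (R : realFieldType) (F : finFieldType).
Hypothesis mulrn_surj : forall a b : F, a != 0 -> exists k, b = a *+ k.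
Hypothesis double_inj : injective (fun a : F => a + a).
Local Notation lazy_walk := (@lazy_walk R F).
Local Notation q := #|F|.
Local Notation periods s := (almost_periods s (period_tol R)).

(** When this fails, some [t] shows that the signed sum over [K] takes each value with probability
    at most [2 / q]. Only coordinates in [K] are tested: the others are resampled in the quadratic
    case. *)
Definition structured n (K : {set 'I_n}) (v : 'cV[F]_n) : bool :=
  `[< forall t, uniq t -> {subset t <= K} ->
        2 < q%:R * lazy_walk [seq v i 0 | i <- t] 0 >].

(** Count by coordinate: prescribed on [t], an almost period on the rest of [K], free outside
    [K]. *)
Lemma card_fiber_le n (K : {set 'I_n}) (t : seq 'I_n) (y : seq F) :
  uniq t -> {subset t <= K} ->
  (#|[set v : 'cV[F]_n | ([seq v i 0%R | i <- t] == y) &&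
      [forall i in K, (i \notin t) ==> (v i 0%R \in periods y)]]| <=
   q ^ (n - #|K|) * #|periods y| ^ (#|K| - size t))%N.
Proof.
move=> ut tK; set P := periods y.
pose A (i : 'I_n) : {set F} :=
  if i \in t then [set nth 0 y (index i t)] else if i \in K then P else setT.
pose col_fun (v : 'cV[F]_n) := [ffun i => v i 0].
have col_inj : injective col_fun.
  move=> v w /ffunP vw; apply/matrixP => i j.
  by have := vw i; rewrite !ffunE ord1.
rewrite -(card_imset _ col_inj).
apply: leq_trans (_ : #|[set f : {ffun 'I_n -> F} | [forall x, f x \in A x]]| <= _)%N.
  apply: subset_leq_card; apply/subsetP => f /imsetP[v].
  rewrite inE => /andP[/eqP vy /forallP vP] ->; rewrite inE; apply/forallP => i.
  rewrite ffunE /A; case: (boolP (i \in t)) => it.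
    rewrite -vy inE (nth_map i) ?index_mem // nth_index //.
  by case: (boolP (i \in K)) => iK; [have := vP i; rewrite iK it | rewrite inE].
rewrite card_family_prod (bigID (mem K)) /= mulnC; apply: leq_mul.
  rewrite (eq_bigr (fun=> q)) => [|i iK].
    rewrite prod_nat_const; case: (posnP q) => [|q0].
      by move/card0_eq/(_ 0); rewrite !inE.
    rewrite leq_pexp2l // (_ : #|_| = n - #|K|)%N //.
    by have := cardC (mem K); rewrite card_ord => /(canRL (addKn _)) <-.
  rewrite /A (negPf iK); case: ifP => [/tK|_]; last by rewrite cardsT.
  by rewrite (negPf iK).
rewrite (bigID (mem t)) /= big1 => [|i /andP[_ it]]; last by rewrite /A it cards1.
rewrite mul1n (eq_bigr (fun=> #|P|)) => [|i /andP[iK it]].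
  rewrite prod_nat_const (_ : #|(fun i => (i \in K) && (i \notin t))| = #|K| - size t)%N //.
  rewrite -(card_uniqP ut) -(cardID (mem t) (mem K)) /=.
  rewrite (_ : #|[predI mem K & mem t]| = #|t|).
    by rewrite addKn; apply: eq_card => i; rewrite !inE andbC.
  apply: eq_card => i; rewrite !inE; apply: andb_idl; exact: tK.
by rewrite /A (negPf it) iK.
Qed.

Lemma lazy_walk1 (a : F) : a != 0 -> lazy_walk [:: a] 0 = 3 / 4.
Proof.
move=> a0; rewrite lazy_walk_cons0 /= eqxx.
have -> : (a + a == 0) = false.
  apply/negbTE; apply: contra a0 => /eqP h; apply/eqP/double_inj.
  by rewrite h addr0.
by rewrite mul0r addr0 mulr1.
Qed.

(** If 0 is the only almost period, [v] is determined on [K], and one nonzero coordinate bounds each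
    proportion by [(3 / 4) ^+ n.-1], whence the predecessor in the bound. Otherwise the number of
    almost periods times the return probability is at most 1/2, so the proportions beat the number
    of vectors coordinate by coordinate. *)
Lemma sum_fiber_le n m (K : {set 'I_n}) (t : seq 'I_n) (y : seq F) (w : 'cV[F]_n) :
  uniq t -> {subset t <= K} -> (size t <= m)%N -> 2 < q%:R * lazy_walk y 0 ->
  \sum_(v : 'cV[F]_n | [&& v != 0, [seq v i 0 | i <- t] == y &
      [forall i in K, (i \notin t) ==> (v i 0 \in periods y)]])
    #|[set A in sign_sym F n | A *m v == w]|%:R <=
  q%:R ^+ (n - #|K|) * (3 / 4) ^+ (#|K| - m).-1 * #|sign_sym F n|%:R :> R.
Proof.
move=> ut tK szt big.
set S := #|sign_sym F n|%:R.
have S0 : 0 <= S :> R by rewrite ler0n.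
have Kn : (#|K| <= n)%N by rewrite -[n in (_ <= n)%N]card_ord max_card.
have cf := card_fiber_le y ut tK; rewrite -(ler_nat R) natrM !natrX in cf.
have cf' (c : R) : 0 <= c -> (forall v : 'cV[F]_n, v != 0 -> [seq v i 0 | i <- t] = y ->
   #|[set A in sign_sym F n | A *m v == w]|%:R <= c) ->
   \sum_(v : 'cV[F]_n | [&& v != 0, [seq v i 0 | i <- t] == y &
      [forall i in K, (i \notin t) ==> (v i 0 \in periods y)]])
    #|[set A in sign_sym F n | A *m v == w]|%:R <=
   q%:R ^+ (n - #|K|) * #|periods y|%:R ^+ (#|K| - size t) * c.
  move=> c0 hc; apply: le_trans (ler_wpM2r c0 cf).
  apply: le_trans (_ : \sum_(v : 'cV[F]_n | [&& v != 0, [seq v i 0 | i <- t] == y &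
      [forall i in K, (i \notin t) ==> (v i 0 \in periods y)]]) c <= _).
    by apply: ler_sum => v /and3P[v0 /eqP vy _]; apply: hc.
  rewrite sumr_const -[leLHS]mulr_natl ler_wpM2r // ler_nat subset_leq_card //.
  by apply/subsetP => v; rewrite !inE => /andP[].
have expo (c : R) k l : 0 <= c -> c <= 1 -> (k <= l)%N -> c ^+ l <= c ^+ k.
  by move=> c0 c1 kl; apply: ler_wiXn2l.
have [P0|half] := almost_periods_small mulrn_surj double_inj big.
  apply: (le_trans (cf' ((3 / 4) ^+ n.-1 * S) _ _)).
  - by rewrite mulr_ge0 // exprn_ge0 //; lra.
  - move=> v v0 _; have [i vi] : exists i, v i 0 != 0.
      apply/existsP; rewrite -negb_forall; apply: contra v0 => /forallP v0.
      apply/eqP/matrixP => i j; rewrite ord1 mxE; exact/eqP.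
    have := @card_sign_sym_mulmx_le R F n v w [:: i] erefl.
    by rewrite /= subn1 -/(lazy_walk [:: v i 0] 0) lazy_walk1.
  rewrite P0 cards1 expr1n mulr1 mulrA ler_wpM2r // ler_wpM2l ?exprn_ge0 //.
  apply: expo; [lra|lra|].
  by rewrite -!subn1; apply: leq_sub2r; apply: leq_trans Kn; apply: leq_subr.
apply: (le_trans (cf' (lazy_walk y 0 ^+ (n - size t) * S) _ _)).
- by rewrite mulr_ge0 // exprn_ge0 // lazy_walk_ge0.
- by move=> v _ <-; exact: card_sign_sym_mulmx_le.
rewrite mulrA ler_wpM2r // -mulrA ler_wpM2l ?exprn_ge0 //.
apply: le_trans (_ : #|periods y|%:R ^+ (#|K| - size t) * lazy_walk y 0 ^+ (#|K| - size t) <= _).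
  rewrite ler_wpM2l ?exprn_ge0 //; apply: expo; rewrite ?lazy_walk_ge0 ?lazy_walk0_le1 //.
  exact: leq_sub2r.
rewrite -exprMn; apply: le_trans (_ : (3 / 4) ^+ (#|K| - size t) <= _).
  apply: lerXn2r; rewrite ?nnegrE ?mulr_ge0 ?lazy_walk_ge0 //; lra.
apply: expo; [lra|lra|].
by apply: leq_trans (leq_pred _) _; apply: leq_sub2l.
Qed.

(** The factors of the union bound: the length of [t], the choice of [t] and of the values on it,
    then the bound for one fiber. Taking [n.+1] keeps the base positive when [n] is 0. *)
Definition structured_bound n m (K : {set 'I_n}) : R :=
  m.+1%:R * (n.+1 * q)%:R ^+ m * q%:R ^+ (n - #|K|) * (3 / 4) ^+ (#|K| - m).-1.

(** The greedy list [t] of a structured [v] puts [v] in the fiber of [t] and its values [y] on [t],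
    and structuredness gives [2 < q%:R * lazy_walk y 0]. The fiber bounds are summed over all [t]
    and [y]. *)
Lemma card_structured_solution n m (K : {set 'I_n}) (w : 'cV[F]_n) :
  q%:R * (1 - period_tol R / 4) ^+ m < 1 ->
  #|[set A in sign_sym F n |
      [exists v : 'cV[F]_n, [&& v != 0, A *m v == w & structured K v]]]|%:R <=
  structured_bound m K * #|sign_sym F n|%:R.
Proof.
move=> hm.
pose N (v : 'cV[F]_n) : R := #|[set A in sign_sym F n | A *m v == w]|%:R.
apply: le_trans (_ : \sum_(v | (v != 0) && structured K v) N v <= _).
  rewrite -natr_sum ler_nat.
  apply: leq_trans (_ : #|\bigcup_(v : 'cV[F]_n | (v != 0%R) && structured K v)
     [set A in sign_sym F n | A *m v == w]| <= _)%N; last first.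
    exact: card_bigcup_le.
  apply: subset_leq_card; apply/subsetP => A; rewrite inE => /andP[AS /existsP[v]].
  move=> /and3P[v0 Av sv]; apply/bigcupP; exists v; first by rewrite v0.
  by rewrite inE AS.
pose good (l : 'I_m.+1) (t : l.-tuple 'I_n) (y : l.-tuple F) (v : 'cV[F]_n) :=
  [&& uniq t, all (mem K) t, 2 < q%:R * lazy_walk y 0 &
   [&& v != 0, [seq v i 0 | i <- t] == y &
      [forall i in K, (i \notin t) ==> (v i 0 \in periods y)]]].
apply: le_trans (_ : \sum_(l < m.+1) \sum_(t : l.-tuple 'I_n) \sum_(y : l.-tuple F)
    \sum_(v | good l t y v) N v <= _).
  rewrite big_mkcond.
  under [leRHS]eq_bigr => l _ do under eq_bigr => t _ do under eq_bigr => y _ do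
    rewrite big_mkcond.
  under [leRHS]eq_bigr => l _ do under eq_bigr => t _ do rewrite exchange_big /=.
  under [leRHS]eq_bigr => l _ do rewrite exchange_big /=.
  rewrite [leRHS]exchange_big /=; apply: ler_sum => v _.
  case: ifP => [/andP[v0 /asboolP sv]|_]; last first.
    by do 3 (apply: sumr_ge0 => ? _); case: ifP; rewrite ?ler0n.
  have [t [ut tK sz tP]] := greedy_almost_periods (fun i => v i 0) K hm.
  have szl : (size t < m.+1)%N by [].
  pose l := Ordinal szl.
  rewrite (bigD1 l) //= (bigD1 (in_tuple t)) //=.
  have szy : size [seq v i 0 | i <- t] == size t by rewrite size_map.
  have gd : @good l (in_tuple t) (Tuple szy) v.
    apply/and4P; split => //; [exact/allP|exact: sv|].
    rewrite v0 eqxx /=; apply/forallP => i; apply/implyP => iK; apply/implyP => it.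
    exact: tP.
  rewrite (bigD1 (Tuple szy)) //= gd -!addrA lerDl !addr_ge0 //.
  - by apply: sumr_ge0 => ? _; case: ifP; rewrite ?ler0n.
  - by do 2 (apply: sumr_ge0 => ? _); case: ifP; rewrite ?ler0n.
  - by do 3 (apply: sumr_ge0 => ? _); case: ifP; rewrite ?ler0n.
pose C : R := q%:R ^+ (n - #|K|) * (3 / 4) ^+ (#|K| - m).-1 * #|sign_sym F n|%:R.
have C0 : 0 <= C by rewrite !mulr_ge0 ?exprn_ge0 ?ler0n //; lra.
rewrite (_ : _ * _ = \sum_(l < m.+1) (n.+1 * q)%:R ^+ m * C); last first.
  by rewrite sumr_const card_ord -[RHS]mulr_natl /C /structured_bound !mulrA.
apply: ler_sum => l _.
apply: le_trans (_ : \sum_(t : l.-tuple 'I_n) \sum_(y : l.-tuple F) C <= _).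
  apply: ler_sum => t _; apply: ler_sum => y _.
  have [/and3P[ut tK big]|no] := boolP [&& uniq t, all (mem K) t & 2 < q%:R * lazy_walk y 0].
    apply: le_trans (sum_fiber_le (m := m) w ut (allP tK) _ big).
      by rewrite /good ut tK big.
    by rewrite size_tuple -ltnS.
  rewrite big_pred0 // => v; apply: contraNF no => /and4P[-> -> -> _] //.
rewrite !sumr_const !card_tuple card_ord -mulrnA -[leLHS]mulr_natl ler_wpM2r //.
rewrite -natrX ler_nat -expnMn mulnC.
apply: leq_trans (_ : (n.+1 * q) ^ l <= _)%N.
  by case: (val l) => // k; rewrite leq_exp2r // leq_mul2r leqnSn orbT.
have q_gt0 : (0 < q)%N by apply/card_gt0P; exists 0.
by rewrite leq_pexp2l ?muln_gt0 // -ltnS.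
Qed.

End Structured.

(** * Bordered matrices *)

Section Border.
Variables (F : finFieldType).
Implicit Types (n : nat).

Definition sign_col n (e : {ffun 'I_n -> bool}) : 'cV[F]_n := \col_i (-1) ^+ e i.

Definition bordered n (z : bool) (e : {ffun 'I_n -> bool}) (M : 'M[F]_n) : 'M[F]_(1 + n) :=
  block_mx ((-1) ^+ z)%:M (sign_col e)^T (sign_col e) M.

Definition corank n (A : 'M[F]_n) : nat := n - \rank A.

Lemma corank_gt0 n (A : 'M[F]_n) : (0 < corank A)%N = (A \notin unitmx).
Proof. by rewrite subn_gt0 -row_free_unit /row_free ltn_neqAle rank_leq_row andbT. Qed.

Lemma rank_bordered_ge n z e (M : 'M[F]_n) : (\rank M <= \rank (bordered z e M))%N.
Proof.
have ME : M = row_mx 0 1%:M *m bordered z e M *m col_mx 0 1%:M.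
  by rewrite mul_row_block mul_row_col !mul0mx !mul1mx !add0r mulmx0 add0r mulmx1.
by rewrite {1}ME; apply: leq_trans (mxrankM_maxl _ _) _; apply: mxrankM_maxr.
Qed.

Lemma corank_bordered_unit n z e (M : 'M[F]_n) : M \in unitmx ->
  (corank (bordered z e M) <= 1)%N.
Proof.
rewrite -row_free_unit /row_free => /eqP rM.
by rewrite /corank leq_subLR addn1 ltnS -[leqLHS]rM rank_bordered_ge.
Qed.

(** The rank grows by 2 and the size by 1. A multiple of [v^T] extracts the row [(1, 0)] from the
    lower rows, so the rows of [G] span those of the block diagonal matrix of 1 and [col_mx x^T M].
    Moreover [x^T] is not in the row space of [M], which annihilates [v]. *)
Lemma corank_bordered_lt n z e (M : 'M[F]_n) (v : 'cV[F]_n) : M^T = M ->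
  M *m v = 0 -> (sign_col e)^T *m v != 0 -> (corank (bordered z e M) < corank M)%N.
Proof.
move=> MT Mv xv; set G := bordered z e M; set x := sign_col e in xv *.
have vM : v^T *m M = 0 by rewrite -{1}MT -trmx_mul Mv trmx0.
set a := (x^T *m v) 0 0; have xvE : x^T *m v = a%:M := mx11_scalar _.
have vx : v^T *m x = a%:M by rewrite -[v^T *m x]trmxK trmx_mul trmxK xvE tr_scalar_mx.
have a0 : a != 0 by apply: contra xv => /eqP a0; rewrite xvE a0 raddf0.
have sub1 : (row_mx 1%:M 0 <= G)%MS.
  apply/submxP; exists (row_mx 0 (a^-1 *: v^T)).
  rewrite mul_row_block !mul0mx !add0r -!scalemxAl vM vx scaler0 scale_scalar_mx.
  by rewrite mulVf.
have subx : (row_mx 0 x^T <= G)%MS.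
  have -> : row_mx 0 x^T = row_mx 1%:M 0 *m G - (-1) ^+ z *: row_mx 1%:M 0.
    rewrite mul_row_block !mul1mx !mul0mx !addr0 scale_row_mx scaler0 opp_row_mx add_row_mx.
    by rewrite oppr0 addr0 scale_scalar_mx mulr1 subrr.
  by rewrite addmx_sub ?submxMl // eqmx_opp scalemx_sub.
have subM : (row_mx 0 M <= G)%MS.
  have -> : row_mx 0 M = row_mx 0 1%:M *m G - x *m row_mx 1%:M 0.
    rewrite mul_row_block !mul1mx !mul0mx !add0r mul_mx_row mulmx0 mulmx1.
    by rewrite opp_row_mx add_row_mx oppr0 addr0 subrr.
  by rewrite addmx_sub ?submxMl // eqmx_opp mulmx_sub.
have subB : (block_mx 1%:M 0 0 (col_mx x^T M) <= G)%MS.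
  rewrite /block_mx col_mx_sub sub1 /=.
  rewrite -[X in row_mx X _]col_mx0 -block_mxEh block_mxEv col_mx_sub.
  by rewrite subx subM.
have rB := mxrankS subB; rewrite rank_diag_block_mx mxrank1 in rB.
have rM : (\rank M < \rank (col_mx x^T M))%N.
  apply: rank_ltmx; rewrite ltmxE; apply/andP; split.
    by apply/submxP; exists (row_mx 0 1%:M); rewrite mul_row_col mul0mx mul1mx add0r.
  rewrite col_mx_sub submx_refl andbT; apply/negP => /submxP[D xD].
  by move: xv; rewrite xD -mulmxA Mv mulmx0 eqxx.
have rn := rank_leq_row M.
rewrite /corank ltn_subLR ?rank_leq_row //.
have {rM rB} r2 : (\rank M + 2 <= \rank G)%N.
  by apply: leq_trans rB; rewrite addn2 add1n ltnS.
have rG := rank_leq_row G; rewrite -/G.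
apply: leq_trans (_ : \rank M + 2 + (n - \rank M) <= _)%N; last by rewrite leq_add2r.
by rewrite addnAC subnKC // addn2.
Qed.

(** This is the Schur complement: a left kernel vector [(a, y)] has [y = - a x^T M^-1], so [a] is
    nonzero and can be cancelled in the first column. *)
Lemma bordered_singular n z e (M : 'M[F]_n) : M^T = M -> M \in unitmx ->
  bordered z e M \notin unitmx ->
  (sign_col e)^T *m invmx M *m sign_col e = ((-1) ^+ z)%:M.
Proof.
move=> MT Mu; rewrite unitmxE unitfE negbK => /det0P[u u0].
set x := sign_col e; rewrite -[u]hsubmxK; set a := lsubmx u; set y := rsubmx u.
rewrite mul_row_block -[0]hsubmxK => /eq_row_mx[h1 h2].
rewrite !linear0 in h1 h2.
have yE : y = - (a *m x^T *m invmx M).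
  apply: (can_inj (mulmxK Mu)); rewrite mulNmx mulmxKV //.
  by apply/eqP; rewrite -addr_eq0 addrC h2.
have a0 : a != 0.
  apply: contra u0 => /eqP a0; rewrite -[u]hsubmxK -/a -/y yE a0 !mul0mx oppr0.
  by rewrite row_mx0.
move: h1; rewrite yE [a]mx11_scalar !mul_scalar_mx -!scalemxAl -/x mulNmx -!scalemxAl.
rewrite -scalerBr => /eqP; rewrite scaler_eq0; case/orP => [/eqP a00|].
  by move: a0; rewrite [a]mx11_scalar a00 raddf0 eqxx.
by rewrite subr_eq0 => /eqP->.
Qed.

End Border.

Lemma natr_card_sum (R : pzSemiRingType) (T : finType) (A : {set T}) (P : pred T) :
  #|[set x in A | P x]|%:R = \sum_(x in A) (P x)%:R :> R.
Proof.
rewrite -natr_sum -sum1_card; congr (_ %:R).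
rewrite [LHS](eq_bigl (fun x => (x \in A) && P x)) => [|x]; last by rewrite inE.
by rewrite big_mkcondr; apply: eq_bigr => x _; case: (P x).
Qed.

Lemma sqr_sum_le (R : realFieldType) (I : finType) (A : {set I}) (f : I -> R) :
  (\sum_(i in A) f i) ^+ 2 <= #|A|%:R * \sum_(i in A) f i ^+ 2.
Proof.
have : 0 <= \sum_(i in A) \sum_(j in A) (f i - f j) ^+ 2.
  by apply: sumr_ge0 => i _; apply: sumr_ge0 => j _; apply: sqr_ge0.
under eq_bigr => i _ do (under eq_bigr => j _ do rewrite sqrrB -mulr_natl;
  rewrite big_split sumrB /= sumr_const -mulr_sumr -mulr_sumr -[f i ^+ 2 *+ _]mulr_natl).
rewrite big_split sumrB /= sumr_const -!mulr_sumr -mulr_suml -[(\sum_(i in A) _) *+ _]mulr_natl.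
rewrite -expr2; lra.
Qed.

(** * Bordering a singular matrix *)

Section Recursion.
Variables (R : realFieldType) (F : finFieldType).
Hypothesis double_inj : injective (fun a : F => a + a).
Local Notation lazy_walk := (@lazy_walk R F).
Local Notation q := #|F|.
Local Notation S n := (sign_sym F n).
Local Notation col := (@sign_col F _).
Local Notation vec n := {ffun 'I_n -> bool}.

Lemma sign_inj (b c : bool) : (-1) ^+ b = (-1) ^+ c :> F -> b = c.
Proof.
have neq : (-1 : F) <> 1.
  move=> h; have /double_inj/eqP : (1 : F) + 1 = 0 + 0 by rewrite -{1}h addNr addr0.
  by rewrite oner_eq0.
by case: b c => -[] //=; rewrite ?expr0 ?expr1 => // /esym.
Qed.

(** Bordering is a bijection: [h'] reads the block and the signs back, which uses [1 <> -1] in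
    [F]. *)
Lemma sum_sign_sym_recr n (f : 'M[F]_(1 + n) -> R) :
  \sum_(A in S (1 + n)) f A =
  \sum_(M in S n) \sum_(e : vec n) \sum_(z : bool) f (bordered z e M).
Proof.
under [RHS]eq_bigr => M _ do rewrite pair_big /=.
rewrite pair_big_dep /=.
pose h (u : 'M[F]_n * (vec n * bool)) := bordered u.2.2 u.2.1 u.1.
pose h' (A : 'M[F]_(1 + n)) : 'M[F]_n * (vec n * bool) :=
  (drsubmx A, ([ffun i => dlsubmx A i 0 == -1], ulsubmx A 0 0 == -1)).
have sgE (b : bool) : ((-1) ^+ b == -1 :> F) = b.
  by apply/eqP/idP => [h1|->//]; rewrite (@sign_inj b true).
rewrite (reindex_onto h h') /=; last first.
  move=> A /sign_symP[AT A1].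
  have sg a : a = 1 \/ a = -1 -> (-1) ^+ (a == -1) = a :> F.
    by case=> ->; rewrite ?eqxx // -[1 in LHS](expr0 (-1)) (sgE false).
  have dlE : sign_col F [ffun i => dlsubmx A i 0 == -1] = dlsubmx A.
    apply/matrixP => i j; rewrite ord1 ![in LHS]mxE !ffunE sg //.
    by rewrite !mxE; apply: A1.
  rewrite -[RHS]submxK /h /bordered /= dlE trmx_dlsub AT; congr block_mx.
  apply/matrixP => i j; rewrite !ord1 [in LHS]mxE mulr1n.
  by rewrite sg //; rewrite !mxE; apply: A1.
apply: eq_big => [[M [e z]]|[M [e z]] _] //=.
rewrite /h /h' /=; have -> : drsubmx (bordered z e M) = M by rewrite block_mxKdr.
have -> : [ffun i => dlsubmx (bordered z e M) i 0 == -1] = e.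
  by apply/ffunP => i; rewrite ffunE block_mxKdl mxE sgE.
have -> : (ulsubmx (bordered z e M) 0 0 == -1) = z.
  by rewrite block_mxKul mxE mulr1n sgE.
rewrite eqxx !andbT; apply/sign_symP/sign_symP => -[MT M1]; split.
- by move: MT; rewrite tr_block_mx => /eq_block_mx[].
- move=> i j; have := M1 (rshift 1 i) (rshift 1 j).
  by rewrite /bordered block_mxEdr.
- by rewrite /bordered tr_block_mx trmxK MT tr_scalar_mx.
have b1 (b : bool) : (-1) ^+ b = 1 \/ (-1) ^+ b = -1 :> F by case: b; auto.
move=> i j; rewrite -(splitK i) -(splitK j).
case: (split i) => i'; case: (split j) => j'; rewrite /= /bordered.
- by rewrite block_mxEul mxE !ord1 mulr1n; exact: b1.
- by rewrite block_mxEur !mxE; exact: b1.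
- by rewrite block_mxEdl !mxE; exact: b1.
- by rewrite block_mxEdr; exact: M1.
Qed.

Lemma card_sign_symS n : #|S (1 + n)|%:R = 2 * 2 ^+ n * #|S n|%:R :> R.
Proof.
rewrite -[LHS]mulr1 mulr_natl -sumr_const (sum_sign_sym_recr (fun=> 1)).
rewrite (eq_bigr (fun=> 2 * 2 ^+ n)) => [|M _]; first by rewrite sumr_const -[LHS]mulr_natl mulrC.
rewrite (eq_bigr (fun=> 2)) => [|e _]; last by rewrite sumr_const card_bool.
by rewrite sumr_const card_ffun card_bool card_ord -[LHS]mulr_natl natrX mulrC.
Qed.

Definition has_structured_solution n (K : {set 'I_n}) (M : 'M[F]_n) (w : 'cV[F]_n) :=
  [exists v : 'cV[F]_n, [&& v != 0, M *m v == w & structured R K v]].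

Lemma sum_sign_unstructured n (K : {set 'I_n}) (v : 'cV[F]_n) (c : F) :
  ~~ structured R K v ->
  \sum_(e : vec n) (\sum_(j in K) (-1) ^+ e j * v j 0 == c)%:R <= 2 ^+ n * (2 / q%:R) :> R.
Proof.
move=> /asboolPn/existsNP[t /not_implyP[ut /not_implyP[tK /negP]]]; rewrite -leNgt => h.
have q0 : 0 < q%:R :> R by rewrite ltr0n; apply/card_gt0P; exists 0.
have := @sum_sign_eq_le R F _ (fun j => v j 0) K t c ut tK.
rewrite card_ord => /le_trans; apply; rewrite ler_wpM2l ?exprn_ge0 //.
by rewrite ler_pdivlMr // mulrC.
Qed.

Lemma sum_unstructured_full n (K : {set 'I_n}) (v : 'cV[F]_n) (c : F) :
  ~~ structured R K v ->
  \sum_(e : vec n) (\sum_j (-1) ^+ e j * v j 0 == c)%:R <= 2 ^+ n * (2 / q%:R) :> R.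
Proof.
move=> nv; have nvT : ~~ structured R [set: 'I_n] v.
  apply: contra nv => /asboolP sv; apply/asboolP => t ut _; apply: sv => // j _.
  by rewrite inE.
apply: le_trans (sum_sign_unstructured c nvT); apply: ler_sum => e _.
by rewrite (eq_bigl (mem [set: 'I_n])) // => j; rewrite !inE.
Qed.

(** A nonzero kernel vector [v] is unstructured by assumption, and the corank can fail to drop only
    if the new column is orthogonal to [v], a linear equation in its signs. *)
Lemma sum_corank_bordered n (K : {set 'I_n}) (M : 'M[F]_n) : M^T = M ->
  (0 < corank M)%N -> ~~ has_structured_solution K M 0 ->
  \sum_(e : vec n) \sum_(z : bool) (corank M <= corank (bordered z e M))%N%:R <=
  2 * 2 ^+ n * (2 / q%:R) :> R.
Proof.
move=> MT cM ns.
have [v v0 Mv] : exists2 v : 'cV[F]_n, v != 0 & M *m v = 0.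
  move: cM; rewrite corank_gt0 unitmxE unitfE negbK => /det0P[u u0 uM].
  exists u^T; last by rewrite -{1}MT -trmx_mul uM trmx0.
  by apply: contra u0 => /eqP u0; rewrite -[u]trmxK u0 trmx0.
have nv : ~~ structured R K v.
  by apply: contra ns => sv; apply/existsP; exists v; rewrite v0 Mv eqxx.
rewrite -mulrA; apply: le_trans (ler_wpM2l _ (sum_unstructured_full 0 nv)) => //.
rewrite mulr_sumr; apply: ler_sum => e _.
apply: le_trans (_ : \sum_(z : bool) ((sign_col F e)^T *m v == 0)%:R <= _).
  apply: ler_sum => z _; case: (eqVneq ((sign_col F e)^T *m v) 0) => [_|xv]; first by rewrite ler_nat leq_b1.
  by have := corank_bordered_lt z MT Mv xv; rewrite ltnNge => /negPf->.
rewrite sumr_const card_bool -[leLHS]mulr_natl ler_wpM2l // ler_nat.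
case: (eqVneq ((sign_col F e)^T *m v) 0) => [xv|] //; rewrite (_ : _ == _) //; apply/eqP.
have := congr1 (fun A : 'M_1 => A 0 0) xv; rewrite !mxE => xv0.
by rewrite -[RHS]xv0; apply: eq_bigr => j _; rewrite !mxE.
Qed.

End Recursion.

(** * Bordering an invertible matrix: decoupling the quadratic form *)

Section Quadratic.
Variables (R : realFieldType) (F : finFieldType).
Hypothesis double_inj : injective (fun a : F => a + a).
Local Notation q := #|F|.
Local Notation S n := (sign_sym F n).
Local Notation col := (@sign_col F _).
Local Notation vec n := {ffun 'I_n -> bool}.

Definition mix n (K : {set 'I_n}) (a b : vec n) : vec n :=
  [ffun i => if i \in K then a i else b i].

Lemma sum_mix n (K : {set 'I_n}) (f : vec n -> R) :
  \sum_(a : vec n) \sum_(b : vec n) f (mix K a b) = 2 ^+ n * \sum_(e : vec n) f e.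
Proof.
rewrite pair_big /=.
(* Exchanging the coordinates of [a] and [b] outside [K] permutes the pairs, so [mix K a b] is
   uniform. *)
pose h (u : vec n * vec n) := (mix K u.1 u.2, mix K u.2 u.1).
have hK : involutive h.
  by case=> a b; rewrite /h /=; congr pair; apply/ffunP => i; rewrite !ffunE; case: (i \in K).
rewrite (reindex_inj (inv_inj hK)) /=.
rewrite (eq_bigr (fun u => f u.1)) => [|[a b] _ /=]; last first.
  by congr f; apply/ffunP => i; rewrite !ffunE; case: (i \in K).
rewrite -(pair_big predT predT (fun a (_ : vec n) => f a)) /= mulr_sumr.
apply: eq_bigr => a _.
by rewrite sumr_const card_ffun card_bool card_ord -[LHS]mulr_natl natrX.
Qed.

(** The difference of two columns that share their signs on [K]. It does not depend on those signs,
    so it is a fixed right-hand side while [a] varies. *)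
Definition mix_diff n (K : {set 'I_n}) (b b' : vec n) : 'cV[F]_n :=
  \col_i if i \in K then 0 else (-1) ^+ b i - (-1) ^+ b' i.

Lemma mix_diffE n (K : {set 'I_n}) (a b b' : vec n) :
  mix_diff K b b' = col (mix K a b) - col (mix K a b').
Proof. by apply/matrixP => i j; rewrite !mxE !ffunE; case: ifP; rewrite ?subrr. Qed.

Definition quadratic_event n (z : bool) (M : 'M[F]_n) (e : vec n) : bool :=
  (M \in unitmx) && ((col e)^T *m invmx M *m col e == ((-1) ^+ z)%:M).

Lemma polarization n (M : 'M[F]_n) (x y : 'cV[F]_n) : M^T = M ->
  x^T *m M *m x = y^T *m M *m y -> (x + y)^T *m (M *m (x - y)) = 0.
Proof.
move=> MT xy; have sym : x^T *m M *m y = y^T *m M *m x.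
  have tr1 (A : 'M[F]_1) : A^T = A by rewrite [A]mx11_scalar tr_scalar_mx.
  by rewrite -[LHS]tr1 !trmx_mul trmxK MT mulmxA.
rewrite linearD /= mulmxDl !mulmxBr !mulmxA xy sym.
by rewrite addrA subrK subrr.
Qed.

(** By [polarization], both events force [(x + y)^T v = 0], where [x] and [y] are the two columns
    and [v = M^-1 w]. On [K] the columns agree, so this is a linear equation in the signs [a] on
    [K]. As a nonzero solution of [M v = w], [v] is unstructured. *)
Lemma sum_quadratic_event n (K : {set 'I_n}) z (M : 'M[F]_n) (b b' : vec n) :
  M^T = M -> mix_diff K b b' != 0 ->
  ~~ has_structured_solution R K M (mix_diff K b b') ->
  \sum_(a : vec n) (quadratic_event z M (mix K a b) && quadratic_event z M (mix K a b'))%:R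
   <= 2 ^+ n * (2 / q%:R) :> R.
Proof.
move=> MT w0 ns; set w := mix_diff K b b' in w0 ns.
have [Mu|Mu] := boolP (M \in unitmx); last first.
  rewrite big1 => [|a _]; last by rewrite /quadratic_event (negPf Mu).
  by rewrite mulr_ge0 ?exprn_ge0 ?divr_ge0.
pose v := invmx M *m w.
have Mv : M *m v = w by rewrite mulmxA mulmxV // mul1mx.
have nv : ~~ structured R K v.
  apply: contra ns => sv; apply/existsP; exists v; rewrite Mv eqxx sv !andbT.
  by apply: contra w0 => /eqP v0; rewrite -Mv v0 mulmx0.
have two0 : (2 : F) != 0.
  apply/eqP => h; have /double_inj/eqP : (1 : F) + 1 = 0 + 0 by rewrite addr0 -h.
  by rewrite oner_eq0.
pose c := \sum_(i | i \notin K) ((-1) ^+ b i + (-1) ^+ b' i) * v i 0.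
apply: le_trans (sum_sign_unstructured (- c / 2) nv); apply: ler_sum => a _.
case: (boolP (_ && _)) => // /andP[/andP[_ /eqP h1] /andP[_ /eqP h2]].
have invT : (invmx M)^T = invmx M by rewrite trmx_inv MT.
have := polarization invT (etrans h1 (esym h2)); rewrite -mix_diffE -/w -/v => h.
suff -> : \sum_(j in K) (-1) ^+ a j * v j 0 == - c / 2 by [].
have := congr1 (fun A : 'M_1 => A 0 0) h; rewrite mxE [RHS]mxE (bigID (mem K)) /=.
rewrite (eq_bigr (fun j => 2 * ((-1) ^+ a j * v j 0))) => [|j jK]; last first.
  by rewrite !mxE !ffunE jK; ring.
rewrite [X in _ + X = _](_ : _ = c); last first.
  by apply: eq_bigr => j jK; rewrite !mxE !ffunE (negPf jK).
rewrite -mulr_sumr => /eqP; rewrite addr_eq0 => /eqP <-.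
by rewrite mulrC mulKf.
Qed.

(** The difference vanishes only if [b'] agrees with [b] outside [K]. *)
Lemma card_mix_diff0 n (K : {set 'I_n}) (b : vec n) :
  \sum_(b' : vec n) (mix_diff K b b' == 0)%:R <= 2 ^+ #|K| :> R.
Proof.
pose A i : {set bool} := if i \in K then setT else [set b i].
rewrite -natr_sum -natrX ler_nat.
apply: leq_trans (_ : #|[set f : {ffun 'I_n -> bool} | [forall x, f x \in A x]]| <= _)%N.
  rewrite -sum1_card [leqRHS]big_mkcond; apply: leq_sum => b' _.
  case: eqP => // /matrixP w0; rewrite inE; case: forallP => // -[] i.
  rewrite /A; case: (boolP (i \in K)) => iK; first by rewrite inE.
  have := w0 i 0; rewrite !mxE (negPf iK) => /eqP; rewrite subr_eq0 => /eqP/(sign_inj double_inj) ->.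
  by rewrite inE.
rewrite card_family_prod (bigID (mem K)) /= mulnC big1 => [|i iK].
  rewrite mul1n (eq_bigr (fun=> 2%N)) ?prod_nat_const // => i iK.
  by rewrite /A iK cardsT card_bool.
by rewrite /A (negPf iK) cards1.
Qed.

Variables (n : nat) (K : {set 'I_n}) (B : R).
Hypothesis structured_le : forall w : 'cV[F]_n,
  #|[set A in S n | has_structured_solution R K A w]|%:R <= B * #|S n|%:R.

(** Three contributions: resamples that coincide outside [K], a structured solution for the
    difference, and the linear equation on [K]. *)
Let D : R := 2 ^+ #|K| / 2 ^+ n + B + 2 / q%:R.

(** Cauchy-Schwarz over the pairs [(M, a)] turns the square of the inner sum over [b] into a sum
    over independent copies [b] and [b'], to which [sum_quadratic_event] applies. *)
Lemma sum_quadratic_event_sqr z :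
  (\sum_(M in S n) \sum_(e : vec n) (quadratic_event z M e)%:R) ^+ 2 <=
  D * (2 ^+ n * #|S n|%:R) ^+ 2.
Proof.
pose h (M : 'M[F]_n) (e : vec n) : R := (quadratic_event z M e)%:R.
pose X := \sum_(M in S n) \sum_(e : vec n) h M e.
have Xmix : 2 ^+ n * X =
    \sum_(u in setX (S n) [set: vec n]) \sum_(b : vec n) h u.1 (mix K u.2 b).
  rewrite mulr_sumr (eq_bigr (fun M => \sum_(a : vec n) \sum_(b : vec n) h M (mix K a b))).
    rewrite pair_big_dep /=; apply: eq_bigl => -[M a].
    by rewrite !inE andbT.
  by move=> M _; rewrite sum_mix.
have two_gt0 : 0 < 2 ^+ n :> R by rewrite exprn_gt0.
have CS := sqr_sum_le (setX (S n) [set: vec n])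
  (fun u => \sum_(b : vec n) h u.1 (mix K u.2 b)).
rewrite -Xmix cardsX cardsT card_ffun card_bool card_ord natrM natrX in CS.
have pairE : \sum_(u in setX (S n) [set: vec n]) (\sum_(b : vec n) h u.1 (mix K u.2 b)) ^+ 2 =
   \sum_(b : vec n) \sum_(b' : vec n) \sum_(M in S n) \sum_(a : vec n)
     (quadratic_event z M (mix K a b) && quadratic_event z M (mix K a b'))%:R.
  under eq_bigr => u _ do rewrite expr2 mulr_suml.
  rewrite exchange_big /=; apply: eq_bigr => b _.
  under eq_bigr => u _ do rewrite mulr_sumr.
  rewrite exchange_big /=; apply: eq_bigr => b' _.
  rewrite pair_big_dep /=; apply: eq_big => [[M a]|[M a] _] /=; first by rewrite !inE andbT.
  by rewrite /h -natrM mulnb.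
pose T : R := #|S n|%:R.
have T0 : 0 <= T by rewrite ler0n.
have inner b b' : \sum_(M in S n) \sum_(a : vec n)
     (quadratic_event z M (mix K a b) && quadratic_event z M (mix K a b'))%:R <=
   (mix_diff K b b' == 0)%:R * (2 ^+ n * T) + 2 ^+ n * (B * T) + 2 ^+ n * (2 / q%:R) * T.
  have triv M : \sum_(a : vec n)
     (quadratic_event z M (mix K a b) && quadratic_event z M (mix K a b'))%:R <= 2 ^+ n :> R.
    rewrite -natr_sum -natrX ler_nat.
    apply: leq_trans (_ : \sum_(a : vec n) 1 <= _)%N.
      by apply: leq_sum => a _; exact: leq_b1.
    by rewrite sum_nat_const card_ffun card_bool card_ord muln1.
  have q0 : 0 <= 2 / q%:R :> R by rewrite divr_ge0.
  have BT0 : 0 <= B * T := le_trans (ler0n _ _) (structured_le 0).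
  have [w0|w0] := eqVneq (mix_diff K b b') 0.
    rewrite mul1r -addrA ler_wpDr //.
      exact: addr_ge0 (mulr_ge0 (ltW two_gt0) BT0) (mulr_ge0 (mulr_ge0 (ltW two_gt0) q0) T0).
    apply: le_trans (ler_sum _ (fun M _ => triv M)) _.
    by rewrite sumr_const -[leLHS]mulr_natl mulrC.
  rewrite mul0r add0r.
  apply: le_trans (_ : \sum_(M in S n)
     (2 ^+ n * (has_structured_solution R K M (mix_diff K b b'))%:R + 2 ^+ n * (2 / q%:R)) <= _).
    apply: ler_sum => M /sign_symP[MT _].
    case: (boolP (has_structured_solution _ _ _ _)) => hs.
      by rewrite mulr1 ler_wpDr // (mulr_ge0 (ltW two_gt0) q0).
    by rewrite mulr0 add0r sum_quadratic_event.
  rewrite big_split /= -mulr_sumr sumr_const lerD //.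
    by rewrite ler_pM2l // -natr_card_sum.
  by rewrite -[leLHS]mulr_natl mulrC.
have : (2 ^+ n * X) ^+ 2 <= T * 2 ^+ n *
   (\sum_(b : vec n) \sum_(b' : vec n)
     ((mix_diff K b b' == 0)%:R * (2 ^+ n * T) + 2 ^+ n * (B * T) + 2 ^+ n * (2 / q%:R) * T)).
  apply: le_trans CS _; rewrite pairE ler_wpM2l ?mulr_ge0 ?(ltW two_gt0) //.
  by apply: ler_sum => b _; apply: ler_sum => b' _.
have cvec (c : R) : \sum_(b : vec n) c = 2 ^+ n * c.
  by rewrite sumr_const card_ffun card_bool card_ord -[LHS]mulr_natl natrX.
have {inner} tot : \sum_(b : vec n) \sum_(b' : vec n)
     ((mix_diff K b b' == 0)%:R * (2 ^+ n * T) + 2 ^+ n * (B * T) + 2 ^+ n * (2 / q%:R) * T) <=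
   2 ^+ n * (2 ^+ #|K| * (2 ^+ n * T) + 2 ^+ n * (2 ^+ n * (B * T) + 2 ^+ n * (2 / q%:R) * T)).
  rewrite -[leRHS]cvec; apply: ler_sum => b _.
  under eq_bigr => b' _ do rewrite -addrA.
  rewrite big_split /= cvec lerD2r -mulr_suml ler_wpM2r ?mulr_ge0 ?exprn_ge0 //.
  exact: card_mix_diff0.
move/le_trans => /(_ _ (ler_wpM2l _ tot)) => h2.
have {h2} : (2 ^+ n * X) ^+ 2 <= T * 2 ^+ n * (2 ^+ n *
  (2 ^+ #|K| * (2 ^+ n * T) + 2 ^+ n * (2 ^+ n * (B * T) + 2 ^+ n * (2 / q%:R) * T))).
  by apply: h2; rewrite mulr_ge0 // ltW.
rewrite -/X -/T exprMn => h2.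
rewrite -(ler_pM2l (exprn_gt0 2 two_gt0)); apply: le_trans h2 _.
have q0 : q%:R != 0 :> R by rewrite pnatr_eq0 -lt0n; apply/card_gt0P; exists 0.
rewrite le_eqVlt; apply/orP; left; apply/eqP; rewrite /D.
by field; rewrite q0 gt_eqF.
Qed.

Lemma sum_quadratic_bordered :
  (\sum_(M in S n) \sum_(e : vec n) \sum_(z : bool)
    ((M \in unitmx) && (bordered z e M \notin unitmx))%:R) ^+ 2 <=
  D * #|S (1 + n)|%:R ^+ 2.
Proof.
pose X z : R := \sum_(M in S n) \sum_(e : vec n) (quadratic_event z M e)%:R.
have X0 z : 0 <= X z by apply: sumr_ge0 => M _; apply: sumr_ge0.
have h : \sum_(M in S n) \sum_(e : vec n) \sum_(z : bool)
    ((M \in unitmx) && (bordered z e M \notin unitmx))%:R <= X true + X false.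
  rewrite -big_bool /= [X in _ <= X]exchange_big /=; apply: ler_sum => M /sign_symP[MT _].
  rewrite exchange_big /=; apply: ler_sum => z _; apply: ler_sum => e _.
  case: (boolP (_ && _)) => // /andP[Mu bu].
  by rewrite /quadratic_event Mu (bordered_singular MT Mu bu) eqxx.
apply: le_trans (_ : (X true + X false) ^+ 2 <= _).
  apply: lerXn2r => //; rewrite nnegrE ?addr_ge0 //.
  by do 3 (apply: sumr_ge0 => ? _).
have := (sum_quadratic_event_sqr true, sum_quadratic_event_sqr false).
rewrite -/(X true) -/(X false) card_sign_symS // => -[h1 h2].
set Y := (2 ^+ n * #|S n|%:R) in h1 h2.
rewrite (_ : 2 * 2 ^+ n * _ = 2 * Y); last by rewrite /Y mulrA.
(* The square of a sum is at most twice the sum of squares, hence at most [4 D Y^2], and the new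
   count is [2 Y]. *)
have := sqr_ge0 (X true - X false); move: h1 h2.
by move: (X true) (X false) Y D => x y Y' D' h1 h2 h3; lra.
Qed.

End Quadratic.

(** * Corank along the sequence of bordered matrices *)

Section Chain.
Variables (R : realFieldType) (F : finFieldType).
Hypothesis double_inj : injective (fun a : F => a + a).
Local Notation q := #|F|.
Local Notation S n := (sign_sym F n).
Local Notation vec n := {ffun 'I_n -> bool}.

Lemma card_sign_sym_gt0 n : 0 < #|S n|%:R :> R.
Proof.
rewrite ltr0n; apply/card_gt0P; exists (const_mx 1); apply/sign_symP; split.
  by rewrite trmx_const.
by move=> i j; rewrite mxE; left.
Qed.

Definition corank_prob n k : R := #|[set A in S n | (k <= corank A)%N]|%:R / #|S n|%:R.

Variables (K : forall n, {set 'I_n}) (B : nat -> R).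
Hypothesis structured_le : forall n (w : 'cV[F]_n),
  #|[set A in S n | has_structured_solution R (K n) A w]|%:R <= B n * #|S n|%:R.

(** The parameter [s] stands for the square root left by Cauchy-Schwarz, [R] being only a real
    field. *)
Lemma corank_prob_recr n k (s : R) : 0 <= s ->
  2 ^+ #|K n| / 2 ^+ n + B n + 2 / q%:R <= s ^+ 2 -> (0 < k)%N ->
  corank_prob (1 + n) k <=
    corank_prob n k.+1 + (B n + 2 / q%:R) + (k == 1)%N%:R * s.
Proof.
move=> s0 hs k0; have T0 := card_sign_sym_gt0 n; have TS := card_sign_symS R double_inj n.
have TS0 := card_sign_sym_gt0 (1 + n).
rewrite /corank_prob ler_pdivrMr // natr_card_sum sum_sign_sym_recr //.
pose str (M : 'M[F]_n) := has_structured_solution R (K n) M 0.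
(* Corank at least [k] after bordering has four possible sources: a larger corank before, a
   structured kernel vector, a corank that did not drop despite an unstructured kernel, or, for
   [k = 1] alone, an invertible [M]. *)
have pt M e z : ((k <= corank (bordered z e M))%N%:R : R) <=
   (k < corank M)%N%:R + (str M)%:R +
   ([&& 0 < corank M, ~~ str M & corank M <= corank (bordered z e M)])%N%:R +
   (k == 1)%N%:R * ((M \in unitmx) && (bordered z e M \notin unitmx))%:R.
  case: (leqP k _) => [kb|_]; last by rewrite !addr_ge0 ?mulr_ge0.
  case: (leqP k.+1 _) => [_|Mk]; first by rewrite -!addrA lerDl !addr_ge0 ?mulr_ge0.
  rewrite ltnS in Mk.
  case: (str M) => /=; first by rewrite add0r -addrA lerDl !addr_ge0 ?mulr_ge0.
  rewrite (leq_trans Mk kb) andbT -!corank_gt0.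
  case: (posnP (corank M)) => [M0|_] /=; last by rewrite !add0r lerDl mulr_ge0.
  have Mu : M \in unitmx by apply/negPn; rewrite -corank_gt0 M0.
  have k1 : k = 1%N by apply/eqP; rewrite eqn_leq k0 (leq_trans kb) ?corank_bordered_unit.
  have kk : (k == 1)%N by rewrite k1.
  by rewrite Mu kk (leq_trans k0 kb) mulr1 !add0r.
apply: le_trans (ler_sum _ (fun M _ => ler_sum _ (fun e _ => ler_sum _ (fun z _ => pt M e z)))) _.
have sumc (c : R) : \sum_(e : vec n) \sum_(z : bool) c = 2 * 2 ^+ n * c.
  rewrite (eq_bigr (fun=> 2 * c)) => [|e _]; last first.
    by rewrite sumr_const card_bool -[LHS]mulr_natl.
  by rewrite sumr_const card_ffun card_bool card_ord -[LHS]mulr_natl natrX; ring.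
pose lin (M : 'M[F]_n) : R := \sum_(e : vec n) \sum_(z : bool)
  ([&& 0 < corank M, ~~ str M & corank M <= corank (bordered z e M)])%N%:R.
pose qd (M : 'M[F]_n) : R := \sum_(e : vec n) \sum_(z : bool)
  ((M \in unitmx) && (bordered z e M \notin unitmx))%:R.
rewrite (eq_bigr (fun M => 2 * 2 ^+ n * (k < corank M)%N%:R + 2 * 2 ^+ n * (str M)%:R +
   lin M + (k == 1)%N%:R * qd M)) => [|M _]; last first.
  rewrite -!sumc /lin /qd mulr_sumr -!big_split; apply: eq_bigr => e _ /=.
  by rewrite mulr_sumr -!big_split.
rewrite !big_split /= -!mulr_sumr -!natr_card_sum.
have linP : \sum_(M in S n) lin M <= 2 / q%:R * #|S (1 + n)|%:R.
  apply: le_trans (_ : \sum_(M in S n) 2 * 2 ^+ n * (2 / q%:R) <= _).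
    apply: ler_sum => M /sign_symP[MT _]; rewrite /lin.
    have rhs0 : 0 <= 2 * 2 ^+ n * (2 / q%:R) :> R by rewrite mulr_ge0 ?divr_ge0 // mulr_ge0 // exprn_ge0.
    case: (posnP (corank M)) => [M0|M0].
      by rewrite big1 // => e _; rewrite big1.
    case: (boolP (str M)) => [_|sM].
      by rewrite big1 // => e _; rewrite big1.
    exact: (sum_corank_bordered MT M0 sM).
  rewrite sumr_const -[leLHS]mulr_natl TS; lra.
have strP := structured_le (0 : 'cV[F]_n); rewrite -/(str _) in strP.
have qdP : \sum_(M in S n) qd M <= s * #|S (1 + n)|%:R.
  rewrite -(@ler_pXn2r _ 2) ?nnegrE // ?mulr_ge0 //; last first.
    by do 3 (apply: sumr_ge0 => ? _).
  apply: le_trans (sum_quadratic_bordered double_inj (@structured_le n)) _.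
  by rewrite exprMn ler_wpM2r // exprn_ge0.
set P := #|[set A in S n | (k < corank A)%N]|%:R.
have PT : P / #|S n|%:R * #|S (1 + n)|%:R = 2 * 2 ^+ n * P.
  by rewrite TS; field; rewrite gt_eqF.
have strT : 2 * 2 ^+ n * #|[set A in S n | str A]|%:R <= B n * #|S (1 + n)|%:R.
  by rewrite TS mulrCA ler_pM2l ?mulr_gt0 ?exprn_gt0.
have qdT : (k == 1)%N%:R * \sum_(M in S n) qd M <= (k == 1)%N%:R * (s * #|S (1 + n)|%:R).
  exact: ler_wpM2l.
rewrite [leRHS]mulrDl [X in _ <= X + _]mulrDl PT; lra.
Qed.

Lemma corank_prob_le0 n k : (n < k)%N -> corank_prob n k = 0.
Proof.
move=> nk; rewrite /corank_prob (_ : [set _ in _ | _] = set0) ?cards0 ?mul0r //.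
apply/setP => A; rewrite !inE; apply/negbTE; rewrite negb_and -ltnNge.
by rewrite (leq_ltn_trans _ nk) ?orbT // leq_subr.
Qed.

(** Each step back costs [d] and raises the required corank by one. For [k > 1] there is no
    quadratic term, since bordering an invertible matrix gives corank at most 1. *)
Lemma corank_prob_iter n k j (d : R) : (1 < k)%N -> (j <= n)%N ->
  (forall m, (n - j <= m)%N -> (m < n)%N -> B m + 2 / q%:R <= d) ->
  corank_prob n k <= j%:R * d + corank_prob (n - j) (k + j).
Proof.
elim: j n k => [|j IH] n k k1 jn hm; first by rewrite mul0r add0r subn0 addn0.
case: n jn hm => // n jn hm.
have nj : (n.+1 - j.+1 <= n)%N by rewrite subSS leq_subr.
have e2 := hm n nj (ltnSn n).
(* The coefficient of [s] is zero here, so any [s] with [x <= s ^+ 2] will do. *)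
pose x : R := 2 ^+ #|K n| / 2 ^+ n + B n + 2 / q%:R; pose s := 1 + x ^+ 2.
have s0 : 0 <= s by rewrite addr_ge0 // sqr_ge0.
have hs : x <= s ^+ 2.
  rewrite /s; have := sqr_ge0 x; have := sqr_ge0 (x - 1); have := sqr_ge0 (x ^+ 2).
  move: x {s s0} => x; nra.
have := corank_prob_recr s0 hs (ltnW k1); rewrite gtn_eqF // mul0r addr0 => h.
apply: le_trans h _.
have := IH n k.+1 (ltnW k1) jn.
rewrite subSS addSnnS => h2; rewrite -(natr1 j).
have : corank_prob n k.+1 <= j%:R * d + corank_prob (n - j) (k + j.+1).
  by apply: h2 => m m1 m2; apply: hm; rewrite ?subSS // ltnS ltnW.
lra.
Qed.

(** Only the last bordering pays [s]. Going back [n./2] further steps would require corank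
    [2 + n./2] in size [n - n./2], which is impossible. *)
Lemma singular_prob_le n (d s : R) : 0 <= s ->
  2 ^+ #|K n| / 2 ^+ n + B n + 2 / q%:R <= s ^+ 2 ->
  (forall m, (n - n./2 <= m)%N -> (m <= n)%N ->  B m + 2 / q%:R <= d) ->
  #|[set A in S (1 + n) | A \notin unitmx]|%:R <=
  (s + (n./2.+1)%:R * d) * #|S (1 + n)|%:R.
Proof.
move=> s0 hs hd; rewrite -ler_pdivrMr ?card_sign_sym_gt0 //.
have -> : #|[set A in S (1 + n) | A \notin unitmx]|%:R / #|S (1 + n)|%:R =
    corank_prob (1 + n) 1.
  by congr (_%:R / _); apply: eq_card => A; rewrite !inE -corank_gt0.
have := corank_prob_recr s0 hs (ltnSn 0); rewrite eqxx mul1r.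
have h2n : (n./2 <= n)%N by rewrite -[leqRHS]odd_double_half -addnn addnA leq_addl.
have := @corank_prob_iter n 2 n./2 d isT h2n.
have -> : corank_prob (n - n./2) (2 + n./2) = 0.
  apply: corank_prob_le0; rewrite ltn_subLR // addnCA addnn -[ltnLHS]odd_double_half.
  by rewrite ltn_add2r; case: (odd n).
move=> h h1.
have : corank_prob n 2 <= n./2%:R * d + 0.
  by apply: h => m m1 m2; apply: hd => //; exact: ltnW.
have := hd n (leq_subr _ _) (leqnn n); rewrite -natr1; lra.
Qed.

End Chain.

(** * Choice of the parameters *)

Lemma Fp_mulrn_surj p (a b : 'F_p) : a != 0 -> exists k, b = a *+ k.
Proof.
(* The witness is the residue [b / a] read as a natural number. *)
move=> a0; exists (b / a : 'F_p) => /=.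
have h : (b / a : 'F_p)%:R = b / a := @natr_Zp (Zp_trunc (pdiv p)) (b / a).
by rewrite -[RHS]mulr_natl h mulfVK.
Qed.

Lemma Fp_double_inj p : prime p -> (2 < p)%N -> injective (fun a : 'F_p => a + a).
Proof.
move=> pr p2 a b /eqP; rewrite -!mulr2n -subr_eq0 -mulrnBl -mulr_natl mulf_eq0 subr_eq0.
case/orP => [|/eqP//]; rewrite -(dvdn_pcharf (pchar_Fp pr)) => /dvdn_leq.
by move=> /(_ isT); rewrite leqNgt p2.
Qed.

Section Numeric.
Variable R : realFieldType.

Lemma bernoulli_ge (x : R) k : 0 <= x -> 1 + k%:R * x <= (1 + x) ^+ k.
Proof.
move=> x0; elim: k => [|k IH]; first by rewrite mul0r addr0 expr0.
rewrite exprS -natr1; have x1 : 0 <= 1 + x by lra.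
apply: le_trans (ler_wpM2l x1 IH); have : 0 <= k%:R * (x * x) by rewrite !mulr_ge0.
lra.
Qed.

Lemma period_tol_halving : exists k : nat,
  k%:R <= 4000 :> R /\ (1 - period_tol R / 4) ^+ k <= 1 / 2.
Proof.
(* The number [16 * 242 = 4 * 968] is the inverse of [period_tol / 4], so Bernoulli's inequality
   gives [2 <= (1 + x) ^+ k]. *)
have [k kE] : exists k : nat, k%:R = 16 * 242 :> R by exists (16 * 242)%N; rewrite natrM.
exists k; split; first by rewrite kE; lra.
set x := period_tol R / 4.
have kx : k%:R * x = 1 by rewrite kE /x /period_tol; field.
have x0 : 0 <= x by rewrite /x /period_tol; lra.
have x1 : x <= 1 by rewrite /x /period_tol; lra.
have : (1 - x) ^+ k * (1 + x) ^+ k <= 1.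
  by rewrite -exprMn; apply: exprn_ile1; nra.
have := bernoulli_ge k x0; rewrite kx => h.
have : 0 <= (1 - x) ^+ k by rewrite exprn_ge0 // subr_ge0.
move: ((1 - x) ^+ k) ((1 + x) ^+ k) h => a b h a0 ab.
have : a * 2 <= a * b by apply: ler_wpM2l => //; lra.
lra.
Qed.

Lemma natr_le_exp2 k : k.+1%:R <= 2 ^+ k :> R.
Proof. by rewrite -natrX ler_nat ltn_expl. Qed.

(** Taking [n = 2 ^ (2 * h).-1] and [x = 2 ^ h], the requirement of [exists_prime_between] reduces
    to [2 * h < 2 ^ h.-1]. *)
Lemma exists_prime_pow4 h : (8 <= h)%N ->
  exists p, [/\ prime p, (2 ^ h < p)%N & (p <= 2 ^ (2 * h))%N].
Proof.
move=> h8; have e2 : ((2 ^ (2 * h).-1).*2 = 2 ^ (2 * h))%N.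
  by rewrite -mul2n -expnS prednK // muln_gt0 /= (leq_trans _ h8).
have [||p [pr ph pn]] := @exists_prime_between (2 ^ h) (2 ^ (2 * h).-1).
- by rewrite expn_gt0.
- rewrite e2 -expnM ltn_exp2l //.
  have -> : ((2 * h).-1 = h + h.-1)%N by case: h {e2} h8 => // h _; rewrite mul2n -addnn addnS addSn.
  rewrite expnD mulnC ltn_pmul2l ?expn_gt0 //.
  case: h h8 {e2} => // h h7 /=; rewrite ltnS in h7.
  rewrite -(subnKC h7) expnD; move: (h - 7)%N => k.
  have := ltn_expl k (isT : (1 < 2)%N); rewrite -[(2 ^ 7)%N]/128%N; lia.
- by exists p; rewrite -e2.
Qed.

(** The exponent [E] adds those of the three growing factors, plus [h] as the gain. As
    [(3 / 4) ^+ 3 <= 1 / 2], [3 * E] coordinates suffice for a decay of [2 ^+ E]. *)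
Lemma structured_bound_le (F : finFieldType) (h m mm E : nat) (K : {set 'I_m}) :
  (#|F| <= 2 ^ (2 * h))%N -> (m.+1 <= 2 ^ h)%N -> #|K| = (m - h)%N -> (h <= m)%N ->
  E = (mm + 3 * h * mm + 2 * h * h + h)%N -> (h + mm + 1 + 3 * E <= m)%N ->
  structured_bound R F mm K <= (2 ^+ h)^-1.
Proof.
move=> Fh mh cK hm EE mE; rewrite /structured_bound cK subKn //.
have q0 : (0 < #|F|)%N by apply/card_gt0P; exists 0.
have e1 : (3 / 4) ^+ (m - h - mm).-1 <= (2 ^+ E)^-1 :> R.
  have lE : (3 * E <= (m - h - mm).-1)%N by lia.
  apply: le_trans (_ : (3 / 4) ^+ (3 * E) <= _).
    by apply: ler_wiXn2l => //; lra.
  rewrite exprM -exprVn; apply: lerXn2r; rewrite ?nnegrE; lra.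
have e2 : (m.+1 * #|F|)%:R ^+ mm <= (2 ^+ (3 * h * mm)) :> R.
  rewrite -!natrX ler_nat expnM; case: mm {EE mE e1} => // mm; rewrite leq_exp2r //.
  have -> : (3 * h = h + 2 * h)%N by rewrite mulSn.
  by rewrite expnD leq_mul.
have e3 : #|F|%:R ^+ h <= (2 ^+ (2 * h * h)) :> R.
  rewrite -!natrX ler_nat expnM; case: h Fh {mh cK hm EE mE e1 e2} => // h Fh.
  by rewrite leq_exp2r.
have e4 := natr_le_exp2 mm.
apply: le_trans (_ : 2 ^+ mm * 2 ^+ (3 * h * mm) * 2 ^+ (2 * h * h) * (2 ^+ E)^-1 <= _).
  have a1 := ler_pM (ler0n _ _) (exprn_ge0 _ (ler0n _ _)) e4 e2.
  have a2 := ler_pM (mulr_ge0 (ler0n _ _) (exprn_ge0 _ (ler0n _ _)))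
    (exprn_ge0 _ (ler0n _ _)) a1 e3.
  apply: ler_pM a2 e1; first by rewrite !mulr_ge0 ?exprn_ge0.
  by rewrite exprn_ge0 //; lra.
rewrite -!exprD EE [X in (X)^-1]exprD invfM mulrA divff ?mul1r //.
by rewrite expf_neq0 // pnatr_eq0.
Qed.

Lemma singular_sign_sym_le n g : (40 <= g)%N ->
  400 * 1000 * (2 * g%:R) ^+ 2 <= n%:R :> R -> (n.+1 <= 2 ^ g)%N ->
  exists p, [/\ prime p, (2 < p)%N &
    #|[set A in sign_sym 'F_p (1 + n) | A \notin unitmx]|%:R <=
    8 / 2 ^+ g * #|sign_sym 'F_p (1 + n)|%:R :> R].
Proof.
move=> g40 ng n2g; have [h hE] : exists h, h = (2 * g)%N by exists (2 * g)%N.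
have h80 : (80 <= h)%N by lia.
have [p [pr hp ph]] := @exists_prime_pow4 h ltac:(lia).
have p2 : (2 < p)%N.
  apply: leq_ltn_trans hp; rewrite -{1}(expn1 2) leq_pexp2l //; lia.
exists p; split => //.
have dbl := Fp_double_inj pr p2; have surj := @Fp_mulrn_surj p.
have cF : #|'F_p| = p by rewrite card_Fp.
have [k [k4 khalf]] := period_tol_halving.
(* Every [k] greedy steps halve the return probability, and [p <= 2 ^ (2 * h)]; one extra halving
   makes the inequality strict. *)
pose mm := (k * (2 * h + 1))%N.
have tol_mm : #|'F_p|%:R * (1 - period_tol R / 4) ^+ mm < 1.
  rewrite cF /mm exprM; have t0 : 0 <= 1 - period_tol R / 4 by rewrite /period_tol; lra.
  apply: le_lt_trans (_ : 2 ^+ (2 * h) * (1 / 2) ^+ (2 * h + 1) < 1).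
    apply: ler_pM; rewrite ?exprn_ge0 // -?natrX ?ler_nat //.
    by apply: lerXn2r; rewrite ?nnegrE ?exprn_ge0 //; lra.
  rewrite exprD expr1 mulrA -exprMn (_ : 2 * (1 / 2) = 1) ?expr1n; [lra|by field].
(* Leaving out the last [h] coordinates makes the term [2 ^+ #|K n| / 2 ^+ n] equal to the inverse
   of [2 ^+ h]. *)
pose K m : {set 'I_m} := [set i : 'I_m | (i < m - h)%N].
have cK m : #|K m| = (m - h)%N.
  have wi : injective (widen_ord (leq_subr h m)).
    by move=> x y /(congr1 val) /= xy; apply: val_inj.
  rewrite -[RHS]card_ord -(card_imset _ wi).
  apply: eq_card => i; rewrite inE; apply/idP/imsetP => [ih|[j _ ->] /=]; last exact: ltn_ord.
  by exists (Ordinal ih) => //; apply: val_inj.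
pose E := (mm + 3 * h * mm + 2 * h * h + h)%N.
(* Doubled, the left-hand side has leading term [36 k h^2], at most [144000 h^2] because
   [k <= 4000]; the constant [400 * 1000] also absorbs the lower terms. *)
have mE m : (n - n./2 <= m)%N -> (h + mm + 1 + 3 * E <= m)%N.
  apply: leq_trans; have : (h + mm + 1 + 3 * E).*2%:R <= n%:R :> R; last first.
    rewrite ler_nat; move: (_ + 3 * E)%N (odd_double_half n) => x; clear; lia.
  apply: le_trans ng; rewrite -mul2n /E /mm !(natrD, natrM).
  have hR : h%:R = 2 * g%:R :> R by rewrite hE natrM.
  rewrite -hR; have h1 : 80 <= h%:R :> R by rewrite ler_nat.
  have k0 : 0 <= k%:R :> R by [].
  move: (h%:R : R) (k%:R : R) h1 k4 k0 => x y x1 y4 y0.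
  have : y * ((2 * x + 1) * (4 + 9 * x)) <= 4000 * ((2 * x + 1) * (4 + 9 * x)).
    by apply: ler_wpM2r => //; nra.
  have : 80 * x <= x * x by apply: ler_wpM2r => //; lra.
  lra.
have h_le m : (n - n./2 <= m)%N -> (h <= m)%N by move=> /mE; apply: leq_trans; rewrite -!addnA leq_addr.
pose B m := structured_bound R 'F_p mm (K m).
have hB m : (n - n./2 <= m)%N -> (m <= n)%N -> B m <= (2 ^+ h)^-1.
  move=> nm mn; apply: (@structured_bound_le _ h m mm E) => //.
  - by rewrite cF.
  - by apply: leq_trans (_ : 2 ^ g <= _)%N; [apply: leq_trans n2g|rewrite leq_pexp2l // hE leq_pmull].
  - exact: h_le.
  - exact: mE.
have pV : 2 / #|'F_p|%:R <= 2 * (2 ^+ h)^-1 :> R.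
  rewrite cF ler_pM2l // lef_pV2 ?posrE ?exprn_gt0 ?ltr0n ?prime_gt0 //.
  by rewrite -natrX ler_nat ltnW.
have two_h : (2 ^+ h)^-1 = (2 ^+ g)^-1 ^+ 2 :> R by rewrite exprVn -exprM mulnC hE.
set u : R := (2 ^+ g)^-1 in two_h *.
have u0 : 0 < u by rewrite invr_gt0 exprn_gt0.
have un : n.+1%:R * u <= 1.
  by rewrite /u ler_pdivrMr ?exprn_gt0 // mul1r -natrX ler_nat.
have nn : (n - n./2 <= n)%N := leq_subr _ _.
have slv m (w : 'cV['F_p]_m) : #|[set A in sign_sym 'F_p m |
    has_structured_solution R (K m) A w]|%:R <= B m * #|sign_sym 'F_p m|%:R.
  exact: (card_structured_solution surj dbl (K m) w tol_mm).
(* Here [s = 2 u] because [u^2 + u^2 + 2 u^2 = (2 u)^2], and [d = 3 u^2]. Since [(n + 1) u <= 1],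
   the total is at most [2 u + 3 u], below [8 u]. *)
apply: le_trans (@singular_prob_le R 'F_p dbl K B slv n (3 * u ^+ 2) (2 * u) _ _ _) _.
- by rewrite mulr_ge0 // ltW.
- have := hB n nn (leqnn n); rewrite two_h in pV *; rewrite cK.
  have -> : 2 ^+ (n - h) / 2 ^+ n = u ^+ 2.
    rewrite -two_h -[in X in _ / X](subnK (h_le n nn)) exprD.
    by rewrite invfM mulrA divff ?mul1r // expf_neq0 // pnatr_eq0.
  by move: pV; lra.
- by move=> m m1 m2; have := hB m m1 m2; move: pV; rewrite two_h; lra.
rewrite ler_wpM2r //.
have half : n./2.+1%:R <= n.+1%:R :> R.
  by rewrite ler_nat ltnS -[leqRHS]odd_double_half -addnn addnA leq_addl.
have : n./2.+1%:R * u * u <= 1 * u.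
  by rewrite ler_pM2r //; apply: le_trans un; rewrite ler_pM2r.
by rewrite -/u; lra.
Qed.

End Numeric.

From mathcomp Require Import all_classical all_reals all_analysis.
From mathcomp Require Import measurable_realfun.

(** * From the probability space to counting *)

Section SignPatterns.
Variable n : nat.
Implicit Types (w : {ffun upper_index n -> bool}) (i j : 'I_n).

Lemma upper_of_subproof i j :
  ((if (i <= j)%N then (i, j) else (j, i)).1 <= (if (i <= j)%N then (i, j) else (j, i)).2)%N.
Proof. by case: (leqP i j) => //= /ltnW. Qed.

Definition upper_of i j : upper_index n := 
  exist (fun p : 'I_n * 'I_n => is_true (p.1 <= p.2)%N) _ (upper_of_subproof i j).

Lemma upper_ofC i j : upper_of i j = upper_of j i.
Proof.
apply: val_inj => /=; case: (ltngtP i j) => // ij.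
by rewrite (val_inj ij).
Qed.

Lemma upper_of_val (u : upper_index n) : upper_of (val u).1 (val u).2 = u.
Proof. by apply: val_inj => /=; rewrite (valP u); case: (val u). Qed.

Definition pattern_mx (Q : pzRingType) w : 'M[Q]_n := \matrix_(i, j) (-1) ^+ w (upper_of i j).

Lemma map_pattern_mx (Q : pzRingType) w : map_mx intr (pattern_mx int w) = pattern_mx Q w.
Proof. by apply/matrixP => i j; rewrite !mxE rmorphXn rmorphN1. Qed.

Lemma det_pattern_mx_eq0 (R : numDomainType) (F : comNzRingType) w :
  \det (pattern_mx R w) = 0 -> \det (pattern_mx F w) = 0.
Proof.
rewrite -(map_pattern_mx R) -(map_pattern_mx F) !det_map_mx => /eqP; rewrite intr_eq0 => /eqP ->.
by rewrite rmorph0.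
Qed.

(** Two injections: patterns embed into sign matrices over [F], preserving singularity, and a
    symmetric sign matrix is determined by its upper triangle. *)
Lemma card_singular_pattern_le (R : realFieldType) (F : finFieldType) (eps : R) :
  injective (fun a : F => a + a) -> 0 <= eps ->
  #|[set A in sign_sym F n | A \notin unitmx]|%:R <= eps * #|sign_sym F n|%:R ->
  #|[set w : {ffun upper_index n -> bool} | \det (pattern_mx R w) == 0]|%:R <= eps * 2 ^+ #|upper_index n|.
Proof.
move=> dbl eps0 h.
have one_neq : (-1 : F) <> 1.
  move=> e; have /dbl/eqP : (1 : F) + 1 = 0 + 0 by rewrite -{1}e addNr addr0.
  by rewrite oner_eq0.
have pat_inj : injective (pattern_mx F).
  move=> w w' /matrixP ww; apply/ffunP => u.
  have := ww (val u).1 (val u).2; rewrite !mxE upper_of_val.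
  by case: (w u) (w' u) => -[]; rewrite ?expr1 ?expr0 // => /esym.
have pat_sym w : pattern_mx F w \in sign_sym F n.
  apply/sign_symP; split; first by apply/matrixP => i j; rewrite !mxE upper_ofC.
  by move=> i j; rewrite mxE; case: (w _); auto.
apply: le_trans (_ : #|[set A in sign_sym F n | A \notin unitmx]|%:R <= _).
  rewrite ler_nat -(card_imset _ pat_inj); apply: subset_leq_card.
  apply/fintype.subsetP => A /imsetP[w]; rewrite inE => /eqP /(det_pattern_mx_eq0 F) w0 ->.
  by rewrite inE pat_sym unitmxE unitfE w0 eqxx.
apply: le_trans h _; rewrite ler_wpM2l // -natrX ler_nat.
pose f (A : 'M[F]_n) := [ffun u : upper_index n => A (val u).1 (val u).2 == 1].
have -> : (2 ^ #|upper_index n|)%N = #|[set: {ffun upper_index n -> bool}]|.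
  by rewrite cardsT card_ffun card_bool.
have f_inj : {in sign_sym F n &, injective f}.
  move=> A A' /sign_symP[AT A1] /sign_symP[AT' A1'] /ffunP ff; apply/matrixP => i j.
  wlog ij : i j / (i <= j)%N.
    move=> H; case: (leqP i j) => [/H//|/ltnW ji].
    by rewrite -AT -AT' !mxE; exact: H.
  have := ff (upper_of i j); rewrite !ffunE /= ij /=.
  by case: (A1 i j) (A1' i j) => -> [] -> //; rewrite eqxx; move/eqP: one_neq => /negPf->.
by rewrite -(card_in_imset f_inj) subset_leq_card // subsetT.
Qed.

End SignPatterns.

Section Probability.
Local Open Scope classical_set_scope.
Context (d : measure_display) (T : measurableType d) (R : realType).
Variable P : probability T R.

Lemma measure_bigsetU_le (I : Type) (s : seq I) (A : I -> set T) :
  (forall i, measurable (A i)) ->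
  (P (\big[setU/set0]_(i <- s) A i) <= \sum_(i <- s) P (A i))%E.
Proof.
move=> mA; elim: s => [|i s IH]; first by rewrite !big_nil measure0.
rewrite !big_cons; have mU : measurable (\big[setU/set0]_(j <- s) A j) by apply: bigsetU_measurable.
by apply: le_trans (measureU2 P (mA i) mU) _; rewrite leeD2l.
Qed.

Variable n : nat.
Variable M : 'M[{RV P >-> R}]_n.
Hypothesis M_sign : random_symmetric_sign_matrix M.

Lemma measurable_det_realization : measurable_fun setT (fun w => \det (realization M w)).
Proof.
rewrite /determinant; apply: measurable_sum => s.
apply: measurable_funM; first exact: measurable_cst.
apply: measurable_prod => i _; under eq_fun => w do rewrite mxE.
exact: measurable_funPT.
Qed.

(** Entries are signs only almost surely. The event is covered by the cells [E w] of singular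
    patterns, each of equal mass by independence, and the null sets [N i] where an entry is not a
    sign. *)
Lemma singularity_probability_le :
  (singularity_probability M <=
   ((#|[set w : {ffun upper_index n -> bool} | \det (pattern_mx R w) == 0]%SET|%:R / 2 ^+ #|upper_index n|) : R)%:E)%E.
Proof.
have [MT rad indep] := M_sign.
set bad : {set {ffun upper_index n -> bool}} := [set w | _]%SET.
pose X := upper_entry M.
pose E (w : {ffun upper_index n -> bool}) : set T :=
  \bigcap_(i in [set` [set: upper_index n]%SET]) (X i @^-1` [set (-1) ^+ w i]).
pose N i : set T := X i @^-1` (~` ([set 1] `|` [set -1])).
have mX i (A : set R) : measurable A -> measurable (X i @^-1` A).
  by move=> mA; exact: measurable_funPTI.
have m1 (a : R) : measurable [set a] by exact: measurable_set1.
have mE w : measurable (E w).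
  by apply: fin_bigcap_measurable => // i _; exact: mX.
have mN i : measurable (N i).
  by apply: mX; apply: measurableC; apply: measurableU.
have PE w : P (E w) = ((2 ^+ #|upper_index n|)^-1)%:E.
  rewrite (indep [set: upper_index n]%SET (fun i => [set (-1) ^+ w i])) //.
  rewrite (eq_bigr (fun=> (2^-1)%:E)) => [|i _]; last first.
    by have [r1 r2] := rad i; case: (w i); rewrite ?expr0 ?expr1.
  by rewrite prodEFin prodr_const cardsT exprVn.
have PN i : P (N i) = 0.
  have [r1 r2] := rad i.
  rewrite /N -preimage_setC probability_setC; last by apply: mX; apply: measurableU.
  rewrite preimage_setU measureU; try exact: mX.
    transitivity (1 - ((2^-1)%:E + (2^-1)%:E) : \bar R)%E.
      by congr (1 - (_ + _))%E; [exact: r1|exact: r2].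
    have half : 2^-1 + 2^-1 = 1 :> R by field.
    by rewrite -EFinD half subrr.
  rewrite -preimage_setI; apply/seteqP; split => // t /= [-> /eqP].
  by rewrite -subr_eq0 opprK (_ : 1 + 1 = 2) // pnatr_eq0.
have sing_sub : [set w | realization M w \notin unitmx] `<=`
    \big[setU/set0]_(w <- enum bad) E w `|` \big[setU/set0]_(i <- enum (upper_index n)) N i.
  move=> t /= sing; have [[i Ni]|noN] := pselect (exists i, N i t).
    by right; rewrite -bigcup_seq; exists i => //=; rewrite mem_enum.
  left; rewrite -bigcup_seq.
  have sgn i : X i t = 1 \/ X i t = -1.
    by apply: contrapT => h; apply: noN; exists i.
  pose w := [ffun i => X i t == -1].
  have wX i : X i t = (-1) ^+ w i.
    rewrite ffunE; case: (sgn i) => ->; last by rewrite eqxx.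
    by rewrite -subr_eq0 opprK (_ : 1 + 1 = 2) // pnatr_eq0.
  exists w => /=; last by move=> i _ /=; rewrite wX.
  rewrite mem_enum inE; move: sing; rewrite unitmxE unitfE negbK.
  suff -> : realization M t = pattern_mx R w by [].
  apply/matrixP => i j; rewrite !mxE -wX /X /upper_entry /=.
  by case: leqP => // _; rewrite -[in LHS]MT mxE.
rewrite /singularity_probability.
have mS : measurable [set w | realization M w \notin unitmx].
  rewrite (_ : [set w | _] = (fun w => \det (realization M w)) @^-1` [set 0]).
    by rewrite -[_ @^-1` _]setTI; exact: measurable_det_realization.
  by apply/seteqP; split => w /=; rewrite unitmxE unitfE negbK => /eqP.
have mU1 : measurable (\big[setU/set0]_(w <- enum bad) E w).
  by apply: bigsetU_measurable.
have mU2 : measurable (\big[setU/set0]_(i <- enum (upper_index n)) N i).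
  by apply: bigsetU_measurable.
apply: le_trans (le_measure P _ _ sing_sub) _; rewrite ?inE //.
  exact: measurableU.
apply: le_trans (measureU2 P mU1 mU2) _.
apply: le_trans (leeD (measure_bigsetU_le _ mE) (measure_bigsetU_le _ mN)) _.
rewrite [X in (_ + X)%E]big1 ?adde0 //.
rewrite (eq_bigr (fun=> ((2 ^+ #|upper_index n|)^-1)%:E)) => [|w _]; last exact: PE.
by rewrite sumEFin big_const_seq count_predT -cardE iter_addr_0 lee_fin -[leLHS]mulr_natl.
Qed.

End Probability.

(** * Final numerical estimates and conclusion *)

Lemma quadratic_le_exp2 (R : realFieldType) g : (40 <= g)%N ->
  2000 * 1000 * (g%:R + 1) ^+ 2 <= 2 ^+ g :> R.
Proof.
move=> g40; rewrite -(subnKC g40); move: (g - 40)%N => k {g g40}; elim: k => [|k IH].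
  rewrite addn0 (_ : 2 ^+ 40 = (1024 * 1024) * (1024 * 1024) :> R); first lra.
  rewrite -[40%N]/((5 + 5) + (5 + 5) + ((5 + 5) + (5 + 5)))%N !exprD.
  by ring.
rewrite addnS [leRHS]exprS -(natr1 (40 + k)%N); have : 0 <= (40 + k)%:R :> R by [].
have : 40 <= (40 + k)%:R :> R by rewrite ler_nat leq_addr.
move: ((40 + k)%:R : R) (2 ^+ (40 + k) : R) IH => x y IH x40 x0; nra.
Qed.

(** The fourth root of [N] is of order [sqrt g] and [ln N <= g], so the product is at most [39 * g]
    and the divisor 1000 leaves ample room. The 3 pays for the factor [8 = 2 ^ 3] in the singularity
    bound. *)
Lemma pow_quarter_sqrt_ln_le (R : realType) (N g : nat) : (40 <= g)%N -> (0 < N)%N ->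
  N%:R <= 2000 * 1000 * (g%:R + 1) ^+ 2 :> R ->
  (N%:R `^ (4^-1) * Num.sqrt (ln N%:R) / 1000 : R) <= g%:R - 3.
Proof.
move=> g40 N0 Ng; set a := N%:R `^ 4^-1; set b := Num.sqrt (ln N%:R).
have sqr_le (x y : R) : 0 <= y -> x ^+ 2 <= y ^+ 2 -> x <= y.
  by move=> y0; rewrite !leNgt; apply: contraNN => yx; nra.
have g40R : 40 <= g%:R :> R by rewrite ler_nat.
have N1 : 1 <= N%:R :> R by rewrite ler1n.
have a0 : 0 <= a by exact: powR_ge0.
have b0 : 0 <= b by exact: sqrtr_ge0.
have a4 : (a ^+ 2) ^+ 2 = N%:R.
  by rewrite -exprM -powR_mulrn // -powRrM mulVf // powRr1.
(* The constant 1415 is just above the square root of [2000 * 1000]. *)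
have a2 : a ^+ 2 <= 1415 * (g%:R + 1).
  apply: sqr_le; first by lra.
  rewrite a4; apply: le_trans Ng _; move: (g%:R : R) g40R => x x40.
  have := sqr_ge0 (x + 1); lra.
have b2 : b ^+ 2 <= g%:R.
  rewrite sqr_sqrtr ?ln_ge0 // -[leRHS]expRK ler_ln ?posrE ?expR_gt0 //; last lra.
  apply: le_trans Ng (le_trans (quadratic_le_exp2 R g40) _).
  rewrite -[X in expR X]mulr1 expRM_natl; apply: lerXn2r; rewrite ?nnegrE ?expR_ge0 //.
  by apply: le_trans (expR_ge1Dx 1); lra.
rewrite ler_pdivrMr; last by lra.
apply: sqr_le; first by lra.
rewrite exprMn; apply: le_trans (ler_pM (sqr_ge0 _) (sqr_ge0 _) a2 b2) _.
move: (g%:R : R) g40R => x x40; have : 40 * x <= x * x by apply: ler_wpM2r => //; lra.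
by lra.
Qed.

Theorem theorem1p2 (R : realType) :
  exists n0 : nat, forall n : nat, (n0 <= n)%N ->
  forall (d : measure_display) (T : measurableType d) (P : probability T R)
         (M : 'M[{RV P >-> R}]_n),
    random_symmetric_sign_matrix M ->
    (singularity_probability M <=
      (2 `^ (- (n%:R `^ (4^-1) * Num.sqrt (ln n%:R) / 1000)))%:E)%E.
Proof.
pose big g : R := 400 * 1000 * (2 * g%:R) ^+ 2.
(* The size becomes a successor, to match [1 + n], and the threshold makes [g = 40] admissible. *)
exists (Num.bound (big 40%N)).+1; case=> // n; rewrite ltnS => hn d T P M HM.
have big_ge0 g : 0 <= big g by rewrite /big; have := sqr_ge0 (2 * g%:R : R); lra.
have n_big : big 40%N <= n%:R.
  by apply: ltW; apply: lt_le_trans (archi_boundP (big_ge0 _)) _; rewrite ler_nat.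
have g_le g : big g <= n%:R -> (g <= n)%N.
  move=> h; rewrite -(ler_nat R); apply: le_trans h; rewrite /big.
  case: g => [|g]; first by have := sqr_ge0 (2 * 0 : R); lra.
  have : 1 <= g.+1%:R :> R by rewrite ler1n.
  by move: (g.+1%:R : R) => x x1; nra.
(* The largest admissible [g] is taken: maximality bounds [n] above by a multiple of [(g + 1)^2],
   which converts the bound in [g] into one in [n]. *)
case: (ex_maxnP (ex_intro (fun g => big g <= n%:R) 40%N n_big) g_le) => g gn gmax.
have g40 : (40 <= g)%N by exact: gmax.
have nlt : n%:R < big g.+1 by rewrite ltNge; apply/negP => /gmax; rewrite ltnn.
have Ng : n.+1%:R <= 2000 * 1000 * (g%:R + 1) ^+ 2 :> R.
  rewrite -(natr1 n); move: nlt; rewrite /big -(natr1 g).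
  have : 40 <= g%:R :> R by rewrite ler_nat.
  by move: (g%:R : R) (n%:R : R) => x y x40 h; nra.
have n2g : (n.+1 <= 2 ^ g)%N.
  by rewrite -(ler_nat R) natrX; apply: le_trans Ng (quadratic_le_exp2 R g40).
have [p [pr p2 hp]] := singular_sign_sym_le g40 gn n2g.
have u0 : 0 < 2 ^+ g :> R by rewrite exprn_gt0.
have eps0 : 0 <= 8 / 2 ^+ g :> R by rewrite divr_ge0 // ltW.
have cnt := card_singular_pattern_le (Fp_double_inj pr p2) eps0 hp.
apply: le_trans (singularity_probability_le HM) _.
rewrite lee_fin; apply: le_trans (_ : 8 / 2 ^+ g <= _).
  by rewrite ler_pdivrMr ?exprn_gt0.
have y_le := pow_quarter_sqrt_ln_le g40 (ltn0Sn n) Ng.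
apply: le_trans (_ : 2 `^ (3 - g%:R) <= _).
  rewrite powRB ?powR_mulrn //; last by rewrite pnatr_eq0 implybT.
  by rewrite ler_pM2r ?invr_gt0 //; lra.
apply: ler_powR; first by rewrite ler1n.
by rewrite -opprB lerN2.
Qed.
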